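(* Let $\{f_i:X\to Y_i\}_{i\in I}$ be a cone in $\mathsf{CHaus}$. If $\{f_i\}$ is effective-monic and directed, then it is guaranteed commutative.
   Context: All C*-algebras and $*$-homomorphisms are unital. $\mathsf{CHaus}$ is the category of compact Hausdorff spaces and continuous maps. A cone in $\mathsf{CHaus}$ is a small family of morphisms $\{f_i:X\to Y_i\}_{i\in I}$ with common domain. For a functor $F:\mathsf{CHaus}\to\mathsf{Set}$, a family $(\beta_i)_{i\in I}$ with $\beta_i\in F(Y_i)$ is compatible if for all $i,j\in I$ and all morphisms $g:Y_i\to Z$, $h:Y_j\to Z$ with $gf_i=hf_j$ one has $F(g)(\beta_i)=F(h)(\beta_j)$. $F$ satisfies the sheaf condition on $\{f_i\}$ if $\alpha\mapsto (F(f_i)(\alpha))_{i\in I}$ is a bijection from $F(X)$ to the set of compatible families. A cone is effective-monic if every representable functor $\mathsf{CHaus}(W,-)$ satisfies the sheaf condition on it. A cone $\{g_j:Y\to Z_j\}_j$ separates points if the $g_j$ are jointly injective. An effective-monic cone $\{f_i:X\to Y_i\}_{i\in I}$ is directed if for every $i\in I$ there is a cone $\{g_i^j:Y_i\to Z_i^j\}_{j\in J_i}$ which separates points, such that for all $i,i'\in I$, $j\in J_i$, $j'\in J_{i'}$ there are $k\in I$ and morphisms $p:Y_k\to Z_i^j$, $q:Y_k\to Z_{i'}^{j'}$ with $pf_k=g_i^jf_i$ and $qf_k=g_{i'}^{j'}f_{i'}$. For a C*-algebra $A$, the functor $-(A):\mathsf{CHaus}\to\mathsf{Set}$ sends $X$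 to the set $X(A)$ of $*$-homomorphisms $C(X)\to A$ and $f:X\to Y$ to $\alpha\mapsto\alpha\circ C(f)$, where $C(f):C(Y)\to C(X)$, $C(f)(g)=g\circ f$. An effective-monic cone is guaranteed commutative if for every C*-algebra $A$ the functor $-(A)$ satisfies the sheaf condition on it. *)

(* Defs.v *)
From HB Require Import structures.
From mathcomp Require Import all_boot all_order all_algebra.
From mathcomp Require Import complex.
From mathcomp Require Import all_classical all_reals all_analysis.

Set Implicit Arguments.
Unset Strict Implicit.
Unset Printing Implicit Defensive.

Import Order.TTheory GRing.Theory Num.Theory.
Import numFieldNormedType.Exports.

Local Open Scope classical_set_scope.
Local Open Scope ring_scope.

(* The empty space is included: [topologicalType] is not pointed. *)
Record CHaus := MkCHaus {
  CHaus_space :> topologicalType;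
  CHaus_compact : compact [set: CHaus_space];
  CHaus_hausdorff : hausdorff_space CHaus_space }.

Definition CHaus_id (X : CHaus) : continuousType X X := idfun.

Definition CHaus_comp (X Y Z : CHaus) (g : continuousType Y Z)
  (f : continuousType X Y) : continuousType X Z := g \o f.

Record CHausFunctor := MkCHausFunctor {
  fobj :> CHaus -> Type;
  fmap : forall X Y : CHaus, continuousType X Y -> fobj X -> fobj Y;
  fmap_id : forall (X : CHaus) (a : fobj X), fmap (CHaus_id X) a = a;
  fmap_comp : forall (X Y Z : CHaus) (g : continuousType Y Z)
    (f : continuousType X Y) (a : fobj X),
    fmap (CHaus_comp g f) a = fmap g (fmap f a) }.

Definition cone (X : CHaus) (I : Type) (Y : I -> CHaus) : Type :=
  forall i : I, continuousType X (Y i).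

Section Cones.
Context (X : CHaus) (I : Type) (Y : I -> CHaus) (f : cone X Y).

Definition compatible (F : CHausFunctor) (b : forall i, F (Y i)) : Prop :=
  forall (i j : I) (Z : CHaus)
    (g : continuousType (Y i) Z) (h : continuousType (Y j) Z),
    CHaus_comp g (f i) = CHaus_comp h (f j) -> fmap g (b i) = fmap h (b j).

Definition sheaf_condition (F : CHausFunctor) : Prop :=
  set_bij [set: F X] [set b : forall i, F (Y i) | compatible b]
    (fun a i => fmap (f i) a).

Definition separates_points : Prop :=
  forall x x' : X, (forall i, f i x = f i x') -> x = x'.
End Cones.

Section Representable.
Context (W : CHaus).

Let hom_id (X : CHaus) (a : continuousType W X) :
  CHaus_comp (CHaus_id X) a = a.
Proof. exact/continuousEP. Qed.
Let hom_comp (X Y Z : CHaus) (g : continuousType Y Z) (f : continuousType X Y)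
  (a : continuousType W X) :
  CHaus_comp (CHaus_comp g f) a = CHaus_comp g (CHaus_comp f a).
Proof. exact/continuousEP. Qed.

Definition representable : CHausFunctor :=
  @MkCHausFunctor (fun X : CHaus => continuousType W X)
    (fun _ _ f a => CHaus_comp f a) hom_id hom_comp.
End Representable.

Definition effective_monic (X : CHaus) (I : Type) (Y : I -> CHaus)
    (f : cone X Y) : Prop :=
  forall W : CHaus, sheaf_condition f (representable W).

(* [directed] and [guaranteed_commutative] are properties of effective-monic
   cones; [effective_monic] is kept as a separate hypothesis. *)
Definition directed (X : CHaus) (I : Type) (Y : I -> CHaus)
    (f : cone X Y) : Prop :=
  exists (J : I -> Type) (Z : forall i, J i -> CHaus)
    (g : forall i, cone (Y i) (Z i)),
    (forall i, separates_points (g i)) /\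
    forall (i i' : I) (j : J i) (j' : J i'),
      exists (k : I) (p : continuousType (Y k) (Z i j))
        (q : continuousType (Y k) (Z i' j')),
        CHaus_comp p (f k) = CHaus_comp (g i j) (f i) /\
        CHaus_comp q (f k) = CHaus_comp (g i' j') (f i').

(* The scalar field [C] is a parameter here; the complex numbers are [R[i]]
   with [R : realType].  The library's [algType] excludes the zero ring, which
   is a unital C*-algebra (it is [C(X)] for [X] empty), and [pzRingType] cannot
   be joined to [lmodType] without clashing with [algType]; so the unit and the
   product are part of the mixin. *)
HB.mixin Record Lmodule_isStarAlgebra (C : numClosedFieldType) A
    of GRing.Lmodule C A := {
  sone : A;
  smul : A -> A -> A;
  star : A -> A;
  smulA : associative smul;
  smul1l : left_id sone smul;
  smul1r : right_id sone smul;
  smulDl : left_distributive smul +%R;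
  smulDr : right_distributive smul +%R;
  smulZl : forall (a : C) (x y : A), smul (a *: x) y = a *: smul x y;
  smulZr : forall (a : C) (x y : A), smul x (a *: y) = a *: smul x y;
  starK : involutive star;
  starD : {morph star : x y / x + y};
  starZ : forall (a : C) (x : A), star (a *: x) = a^* *: star x;
  starM : forall x y : A, star (smul x y) = smul (star y) (star x) }.

#[short(type="starAlgType")]
HB.structure Definition StarAlgebra (C : numClosedFieldType) :=
  {A of GRing.Lmodule C A & Lmodule_isStarAlgebra C A}.

(* The norm of a [normedModType C] takes its values in the nonnegative reals
   of [C]. *)
HB.mixin Record StarAlgebra_isCStar (C : numClosedFieldType) A
    of StarAlgebra C A & CompleteNormedModule C A := {
  cstar_normM : forall x y : A, `|smul x y| <= `|x| * `|y|;
  cstar_norm_star : forall x : A, `|smul (star x) x| = `|x| ^+ 2 }.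

#[short(type="cstarAlgType")]
HB.structure Definition CStarAlgebra (C : numClosedFieldType) :=
  {A of StarAlgebra C A & CompleteNormedModule C A & StarAlgebra_isCStar C A}.

HB.mixin Record isStarMorphism (C : numClosedFieldType)
    (A B : starAlgType C) (f : A -> B) := {
  star_morph1 : f sone = sone;
  star_morphM : {morph f : x y / smul x y};
  star_morphS : {morph f : x / star x} }.

#[short(type="starHom")]
HB.structure Definition StarHom (C : numClosedFieldType)
    (A B : starAlgType C) :=
  {f of @GRing.Linear C A B *:%R f & @isStarMorphism C A B f}.

Lemma starHomEP (C : numClosedFieldType) (A B : starAlgType C)
  (f g : starHom A B) : f = g <-> f =1 g.
Proof.
split=> [->//|]; case: f g => [f [[[f1 f1']] [f2] [f3 f4 f5]]].
case=> [g [[[g1 g1']] [g2] [g3 g4 g5]]] /= /funext fg.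
rewrite {}fg in f1 f1' f2 f3 f4 f5 *.
rewrite (Prop_irrelevance f1 g1) (Prop_irrelevance f1' g1').
rewrite (Prop_irrelevance f2 g2) (Prop_irrelevance f3 g3).
by rewrite (Prop_irrelevance f4 g4) (Prop_irrelevance f5 g5).
Qed.

Section StarHomComposition.
Context (C : numClosedFieldType) (A B D : starAlgType C).
Context (g : starHom B D) (f : starHom A B).

Let comp1 : (g \o f) sone = sone.
Proof. by rewrite /= !star_morph1. Qed.
Let compM : {morph g \o f : x y / smul x y}.
Proof. by move=> x y; rewrite /= !star_morphM. Qed.
Let compS : {morph g \o f : x / star x}.
Proof. by move=> x; rewrite /= !star_morphS. Qed.

HB.instance Definition _ :=
  isStarMorphism.Build C A D (g \o f) comp1 compM compS.

Definition starHom_comp : starHom A D := g \o f.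
End StarHomComposition.

Definition cont_alg (C : numClosedFieldType) (X : CHaus) : Type :=
  continuousType X C.

Section ContinuousFunctions.
Context (C : numClosedFieldType) (X : CHaus).
Local Notation CX := (cont_alg C X).

HB.instance Definition _ := Choice.on CX.

Definition cont_fun (u : CX) : X -> C := (u : continuousType X C).
Coercion cont_fun : cont_alg >-> Funclass.

Definition cont_mk (u : X -> C) (cu : continuous u) : CX :=
  (mkcts cu : continuousType X C).

Lemma cont_algP (u v : CX) : u = v <-> u =1 v.
Proof. exact: continuousEP. Qed.

Lemma cont_continuous (u : CX) : continuous u.
Proof. exact: (@cts_fun _ _ (u : continuousType X C)). Qed.

Let conj_continuous : continuous (@Num.conj C).
Proof.
move=> z; apply/(@cvgrPdist_lt _ _ _ _ (nbhs_filter z)) => e e0.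
apply: filterS (nbhsx_ballx z e e0) => w.
by rewrite -ball_normE /ball_ /= -rmorphB norm_conjC.
Qed.

Definition cadd (u v : CX) : CX :=
  @cont_mk (fun x => u x + v x)
    (fun x => cvgD (@cont_continuous u x) (@cont_continuous v x)).
Definition copp (u : CX) : CX :=
  @cont_mk (fun x => - u x) (fun x => cvgN (@cont_continuous u x)).
Definition cmul (u v : CX) : CX :=
  @cont_mk (fun x => u x * v x)
    (fun x => cvgM (@cont_continuous u x) (@cont_continuous v x)).
Definition ccst (c : C) : CX := @cont_mk (fun=> c) (fun x => cvg_cst c).
Definition cstar (u : CX) : CX :=
  @cont_mk (fun x => (u x)^*)
    (fun x => cvg_comp _ _ (@cont_continuous u x) (@conj_continuous (u x))).

Let caddA : associative cadd.
Proof. by move=> u v w; apply/cont_algP => x; exact: addrA. Qed.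
Let caddC : commutative cadd.
Proof. by move=> u v; apply/cont_algP => x; exact: addrC. Qed.
Let cadd0 : left_id (ccst 0) cadd.
Proof. by move=> u; apply/cont_algP => x; exact: add0r. Qed.
Let caddN : left_inverse (ccst 0) copp cadd.
Proof. by move=> u; apply/cont_algP => x; exact: addNr. Qed.

HB.instance Definition _ := GRing.isZmodule.Build CX caddA caddC cadd0 caddN.

Let cscaleA a b (u : CX) :
  cmul (ccst a) (cmul (ccst b) u) = cmul (ccst (a * b)) u.
Proof. by apply/cont_algP => x; exact: mulrA. Qed.
Let cscale1 : left_id 1 (fun a => cmul (ccst a)).
Proof. by move=> u; apply/cont_algP => x; exact: mul1r. Qed.
Let cscaleDr : right_distributive (fun a => cmul (ccst a)) +%R.
Proof. by move=> a u v; apply/cont_algP => x; exact: mulrDr. Qed.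
Let cscaleDl (u : CX) : {morph (fun a => cmul (ccst a) u) : a b / a + b}.
Proof. by move=> a b; apply/cont_algP => x; exact: mulrDl. Qed.

HB.instance Definition _ :=
  GRing.Zmodule_isLmodule.Build C CX cscaleA cscale1 cscaleDr cscaleDl.

Let cmulA : associative cmul.
Proof. by move=> u v w; apply/cont_algP => x; exact: mulrA. Qed.
Let cmul1l : left_id (ccst 1) cmul.
Proof. by move=> u; apply/cont_algP => x; exact: mul1r. Qed.
Let cmul1r : right_id (ccst 1) cmul.
Proof. by move=> u; apply/cont_algP => x; exact: mulr1. Qed.
Let cmulDl : left_distributive cmul +%R.
Proof. by move=> u v w; apply/cont_algP => x; exact: mulrDl. Qed.
Let cmulDr : right_distributive cmul +%R.
Proof. by move=> u v w; apply/cont_algP => x; exact: mulrDr. Qed.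
Let cmulZl (a : C) (u v : CX) : cmul (a *: u) v = a *: cmul u v.
Proof. by apply/cont_algP => x; rewrite /=; symmetry; exact: mulrA. Qed.
Let cmulZr (a : C) (u v : CX) : cmul u (a *: v) = a *: cmul u v.
Proof. by apply/cont_algP => x; exact: mulrCA. Qed.
Let cstarK : involutive cstar.
Proof. by move=> u; apply/cont_algP => x; exact: conjCK. Qed.
Let cstarD : {morph cstar : u v / u + v}.
Proof. by move=> u v; apply/cont_algP => x; exact: rmorphD. Qed.
Let cstarZ (a : C) (u : CX) : cstar (a *: u) = a^* *: cstar u.
Proof. by apply/cont_algP => x; exact: rmorphM. Qed.
Let cstarM (u v : CX) : cstar (cmul u v) = cmul (cstar v) (cstar u).
Proof. by apply/cont_algP => x; exact: etrans (rmorphM _ _ _) (mulrC _ _). Qed.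

HB.instance Definition _ := Lmodule_isStarAlgebra.Build C CX
  cmulA cmul1l cmul1r cmulDl cmulDr cmulZl cmulZr cstarK cstarD cstarZ cstarM.
End ContinuousFunctions.

Section Pullback.
Context (C : numClosedFieldType) (X Y : CHaus) (f : continuousType X Y).

Definition cont_comp (u : cont_alg C Y) : cont_alg C X :=
  ((u : continuousType Y C) \o f : continuousType X C).

Let cont_comp_nmod : nmod_morphism cont_comp.
Proof. by split=> [|u v]; exact/cont_algP. Qed.
Let cont_comp_scalable : scalable cont_comp.
Proof. by move=> a u; exact/cont_algP. Qed.
Let cont_comp1 : cont_comp sone = sone.
Proof. exact/cont_algP. Qed.
Let cont_compM : {morph cont_comp : u v / smul u v}.
Proof. by move=> u v; exact/cont_algP. Qed.
Let cont_compS : {morph cont_comp : u / star u}.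
Proof. by move=> u; exact/cont_algP. Qed.

HB.instance Definition _ :=
  GRing.isNmodMorphism.Build (cont_alg C Y) (cont_alg C X) cont_comp
    cont_comp_nmod.
HB.instance Definition _ :=
  GRing.isScalable.Build C (cont_alg C Y) (cont_alg C X) *:%R cont_comp
    cont_comp_scalable.
HB.instance Definition _ :=
  isStarMorphism.Build C (cont_alg C Y) (cont_alg C X) cont_comp
    cont_comp1 cont_compM cont_compS.
End Pullback.

Section StarHomFunctor.
Context (C : numClosedFieldType) (A : cstarAlgType C).

Let hom_map (X Y : CHaus) (f : continuousType X Y)
    (a : starHom (cont_alg C X) A) : starHom (cont_alg C Y) A :=
  starHom_comp a (cont_comp f).

Let hom_map_id (X : CHaus) (a : starHom (cont_alg C X) A) :
  hom_map (CHaus_id X) a = a.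
Proof.
apply/starHomEP => u; rewrite /hom_map /starHom_comp /=.
by congr (a _); exact/cont_algP.
Qed.
Let hom_map_comp (X Y Z : CHaus) (g : continuousType Y Z)
  (f : continuousType X Y) (a : starHom (cont_alg C X) A) :
  hom_map (CHaus_comp g f) a = hom_map g (hom_map f a).
Proof.
apply/starHomEP => u; rewrite /hom_map /starHom_comp /=.
by congr (a _); exact/cont_algP.
Qed.

Definition starHom_functor : CHausFunctor :=
  @MkCHausFunctor (fun X : CHaus => starHom (cont_alg C X) A)
    hom_map hom_map_id hom_map_comp.
End StarHomFunctor.

Definition guaranteed_commutative (R : realType) (X : CHaus) (I : Type)
    (Y : I -> CHaus) (f : cone X Y) : Prop :=
  forall A : cstarAlgType R[i], sheaf_condition f (starHom_functor A).

(* Main.v *)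
Require Import Defs.
From HB Require Import structures.
From mathcomp Require Import all_boot all_order all_algebra complex ring lra.
From mathcomp Require Import all_classical all_reals all_analysis.

(** Write [b i : C(Y i) -> A] for a compatible family of star-homomorphisms.

    Directedness makes the ranges of the [b i] commute.  Functions of the form
    [h \o g i j] and [h' \o g i' j'] both factor, after composition with the
    cone, through a single [Y k], so compatibility puts their images inside the
    commutative range of [b k]; since the cones [g i] separate points, such
    functions generate dense subalgebras of [C(Y i)] and [C(Y i')].
    ([directed_ranges_commute])

    Consider the pairs [(F, T)] in the subalgebra of [C(X) * A] generated by the
    pairs [(u \o f i, b i u)].  The heart of the proof is the estimate that the
    norm of [T] is at most the supremum norm of [F] ([generated_norm_le]).
    Granted this, the closure of the set of pairs is the graph of a map; its
    domain is all of [C(X)] because the [f i] separate points, and the map is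
    the required star-homomorphism.  Its uniqueness is density once more.

    For the estimate, work in the bicommutant of the ranges, a commutative
    C*-algebra containing every [T].  In a commutative C*-algebra each [T] other
    than [0] has a prime ideal [J], with [1] not in its closure, such that a
    scalar congruent to [T] modulo the closure of [J] has modulus the norm of
    [T], if its conjugate is congruent to the adjoint of [T] as well
    ([prime_ideal_attains_norm]).  By compactness of [Y i] the functions that
    [b i] sends into [J] have a common zero [y i], and as [J] is prime, [b i u]
    is congruent to the scalar [u (y i)].  Primality also shows that the family
    [y] is compatible: if [g (y i)] and [h (y j)] were different, bump functions
    around them with product [0] would give two elements outside [J] with
    product [0].  The cone being effective-monic, there is [x] in [X] with
    [f i x = y i] for all [i], so [T] is congruent to [F x], and the norm of [T]
    is the modulus of [F x].

    This replaces Gelfand duality for the bicommutant: primality of [J] is all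
    that the argument uses of a character, and the points come from the [Y i].
    The functional calculus it needs reduces to the existence of square roots
    of [1 - y] for [y] self-adjoint of norm at most [1] ([cs_sqrt]). *)

Set Implicit Arguments.
Unset Strict Implicit.
Unset Printing Implicit Defensive.

Import Order.TTheory GRing.Theory Num.Theory.
Import numFieldNormedType.Exports.

Local Open Scope classical_set_scope.
Local Open Scope ring_scope.

(** The complex numbers as a packaged structure: topological instances are
    attached to [numClosedFieldType], not to the bare carrier [R[i]]. *)
Local Notation complexField R :=
  (complex_complex__canonical__Num_ClosedField R).

(** * Real-valued norms *)

(** Norms of complex normed modules are nonnegative elements of [R[i]]; taking
    the real part moves estimates to the totally ordered field [R]. *)
Definition nrm (R : realType) (V : normedZmodType R[i]) (x : V) : R :=
  complex.Re `|x|.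

Lemma nrmE (R : realType) (V : normedZmodType R[i]) (x : V) :
  ((nrm x)%:C)%C = `|x|.
Proof. by apply: RRe_real; exact: normr_real. Qed.

Section RealNorm.
Context (R : realType).
Local Notation C := (complexField R).

Lemma nrm_ge0 (V : normedZmodType C) (x : V) : 0 <= nrm x.
Proof. by rewrite -(lecR 0) nrmE; exact: normr_ge0. Qed.

Lemma nrm_real (c : R) : nrm ((c%:C)%C : C) = `|c|.
Proof. by rewrite /nrm normc_def /= expr0n addr0 sqrtr_sqr. Qed.

Lemma nrm_eq0 (V : normedZmodType C) (x : V) : nrm x = 0 -> x = 0.
Proof. by move=> x0; apply/normr0_eq0; rewrite -nrmE x0. Qed.

Lemma nrm0 (V : normedZmodType C) : nrm (0 : V) = 0.
Proof. by rewrite /nrm normr0. Qed.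

Lemma nrmN (V : normedZmodType C) (x : V) : nrm (- x) = nrm x.
Proof. by rewrite /nrm normrN. Qed.

Lemma nrmD (V : normedZmodType C) (x y : V) : nrm (x + y) <= nrm x + nrm y.
Proof. by rewrite -lecR rmorphD /= !nrmE; exact: ler_normD. Qed.

Lemma nrm_mul (z w : C) : nrm (z * w) = nrm z * nrm w.
Proof. by apply: (@complexI R); rewrite rmorphM /= !nrmE normrM. Qed.

Lemma nrm_le (V : normedZmodType C) (x : V) (c : R) :
  (nrm x <= c) = (`|x| <= (c%:C)%C).
Proof. by rewrite -lecR nrmE. Qed.

Lemma nrm_small (V : normedZmodType C) (x y : V) :
  (forall e, 0 < e -> nrm (x - y) <= e) -> x = y.
Proof.
move=> xy; apply/eqP; rewrite -subr_eq0; apply/eqP/nrm_eq0/eqP.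
rewrite eq_le nrm_ge0 andbT; apply/ler_addgt0Pl => e e0.
by rewrite addr0; exact: xy.
Qed.

Lemma complete_seq (V : completeNormedModType C) (u : nat -> V) :
  (forall e, 0 < e -> exists n, forall m k, (n <= m)%N -> (n <= k)%N ->
    nrm (u m - u k) <= e) ->
  exists l, forall e, 0 < e -> exists n, forall m, (n <= m)%N ->
    nrm (u m - l) <= e.
Proof.
move=> cu.
have posE (e : C) : 0 < e -> 0 < complex.Re e /\ e = ((complex.Re e)%:C)%C.
  move=> e0; split; first by move: e0; rewrite ltcE => /andP[].
  by rewrite RRe_real // gtr0_real.
have /cauchy_cvgP/cvg_ex[l ul] : cauchy (u @ \oo).
  apply/cauchy_ballP => e /posE[e0 ->].
  have [|n Hn] := cu (complex.Re e / 2); first by rewrite divr_gt0.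
  have Fn : (u @ \oo) [set u m | m in [set m | (n <= m)%N]].
    by exists n => // m nm; exists m.
  pose tail := [set u m | m in [set m | (n <= m)%N]]; exists (tail, tail).
    by split; exact: Fn.
  move=> [_ _] /= [[m nm <-] [k nk <-]].
  rewrite -ball_normE /ball_ /= -nrmE ltcR.
  by apply: le_lt_trans (Hn _ _ nm nk) _; lra.
exists l => e e0; have /cvgrPdist_le/(_ ((e%:C)%C)) := ul.
rewrite (ltcR 0) => /(_ e0)[n _ Hn]; exists n => m /Hn /=.
by rewrite distrC nrm_le.
Qed.

End RealNorm.

(** * Commutative C*-algebras *)

(** The carrier is a commutative ring, scalars enter through a ring morphism
    and completeness is sequential, so that ring identities and real
    inequalities cover all the algebra below. *)
Record commCStar (R : realType) := CommCStar {
  cs_ring :> comPzRingType;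
  cs_norm : cs_ring -> R;
  cs_star : {rmorphism cs_ring -> cs_ring};
  cs_scal : {rmorphism R[i] -> cs_ring};
  cs_starK : involutive cs_star;
  cs_star_scal : forall c, cs_star (cs_scal c) = cs_scal c^*;
  cs_norm_ge0 : forall x, 0 <= cs_norm x;
  cs_norm_eq0 : forall x, cs_norm x = 0 -> x = 0;
  cs_normD : forall x y, cs_norm (x + y) <= cs_norm x + cs_norm y;
  cs_normM : forall x y, cs_norm (x * y) <= cs_norm x * cs_norm y;
  cs_norm_scal : forall c, cs_norm (cs_scal c) <= nrm c;
  cs_norm_star : forall x, cs_norm (cs_star x * x) = cs_norm x ^+ 2;
  cs_complete : forall u : nat -> cs_ring,
    (forall e, 0 < e -> exists n, forall m k, (n <= m)%N -> (n <= k)%N ->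
      cs_norm (u m - u k) <= e) ->
    exists l, forall e, 0 < e -> exists n, forall m, (n <= m)%N ->
      cs_norm (u m - l) <= e }.

Section CommutativeCStar.
Context (R : realType) (B : commCStar R).
Local Notation N := (@cs_norm R B).
Local Notation st := (@cs_star R B).
Local Notation sc := (@cs_scal R B).
Local Notation rs c := (sc (c%:C)%C).

Lemma cs_norm_real (c : R) : N (rs c) <= `|c|.
Proof. by apply: le_trans (cs_norm_scal _ _) _; rewrite nrm_real. Qed.

Lemma cs_star_real c : st (rs c) = rs c.
Proof. by rewrite cs_star_scal; congr (sc _); exact: conjc_real. Qed.

Lemma cs_normN x : N (- x) = N x.
Proof.
have H y : N (- y) <= N y.
  have -> : - y = rs (-1) * y.
    by rewrite (_ : ((-1)%:C)%C = -1 :> R[i]) ?rmorphN1 ?mulN1r // rmorphN1.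
  apply: le_trans (cs_normM _ _) _.
  rewrite -[leRHS]mul1r ler_wpM2r ?cs_norm_ge0 //.
  by apply: le_trans (cs_norm_real _) _; rewrite normrN1.
by apply/eqP; rewrite eq_le H -{1}[x]opprK H.
Qed.

Lemma cs_norm0 : N 0 = 0.
Proof.
apply/eqP; rewrite eq_le cs_norm_ge0 andbT.
by have := cs_norm_real 0; rewrite normr0 rmorph0.
Qed.

Lemma cs_norm_stE x : N (st x) = N x.
Proof.
have H y : N y <= N (st y).
  have [->|y0] := eqVneq (N y) 0; first exact: cs_norm_ge0.
  have := cs_normM (st y) y; rewrite cs_norm_star expr2 ler_pM2r //.
  by rewrite lt_neqAle eq_sym y0 cs_norm_ge0.
by apply/eqP; rewrite eq_le H andbT -{2}[x](cs_starK x) H.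
Qed.

Lemma cs_norm_le0 x : (forall e, 0 < e -> N x <= e) -> x = 0.
Proof.
move=> H; apply: cs_norm_eq0; apply/eqP; rewrite eq_le cs_norm_ge0 andbT.
by apply/ler_addgt0Pl => e e0; rewrite addr0; exact: H.
Qed.

(** For [h = 1/2], a limit [s] of this iteration satisfies [2 s = y + s * s],
    that is [(1 - s) ^ 2 = 1 - y].  The same iteration run in [R] with [y = 1]
    is monotone, bounded by [1] and majorizes the increments of the others
    with [y] of norm at most [1]. *)
Fixpoint sqrt_iter (T : comPzRingType) (h y : T) (n : nat) : T :=
  if n is m.+1 then h * (y + sqrt_iter h y m * sqrt_iter h y m) else 0.

Lemma sqrt_iter_bounds n :
  0 <= sqrt_iter (2^-1 : R) 1 n <= sqrt_iter 2^-1 1 n.+1 /\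
  sqrt_iter (2^-1 : R) 1 n <= 1.
Proof.
elim: n => [|n [/andP[h0 h1] h2]] /=; first by split; [apply/andP; split|]; lra.
move: h0 h1 h2 => /=; set s := sqrt_iter _ _ _ => h0 h1 h2.
split; [apply/andP; split|]; nra.
Qed.

Lemma half_add_half : rs 2^-1 + rs 2^-1 = 1.
Proof. by rewrite -!rmorphD /= [X in rs X](_ : _ = 1) ?rmorph1 //; field. Qed.

Lemma sqrt_iter_le y n : N y <= 1 ->
  N (sqrt_iter (rs 2^-1) y n) <= sqrt_iter 2^-1 1 n /\
  N (sqrt_iter (rs 2^-1) y n.+1 - sqrt_iter (rs 2^-1) y n)
    <= sqrt_iter 2^-1 1 n.+1 - sqrt_iter 2^-1 1 n.
Proof.
move=> y1; have half_le x : N (rs 2^-1 * x) <= 2^-1 * N x.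
  apply: le_trans (cs_normM _ _) _; rewrite ler_wpM2r ?cs_norm_ge0 //.
  by apply: le_trans (cs_norm_real _) _; rewrite ger0_norm //; lra.
elim: n => [|n []].
  rewrite /= cs_norm0 !mulr0 !addr0 !subr0; split => //.
  by apply: le_trans (half_le _) _; lra.
have [/andP[b0 b1] b2] := sqrt_iter_bounds n.
have [/andP[c0 c1] c2] := sqrt_iter_bounds n.+1.
set s := sqrt_iter (rs _) y n.+1; set s0 := sqrt_iter (rs _) y n.
set t := sqrt_iter 2^-1 1 n.+1; set t0 := sqrt_iter 2^-1 1 n => h1 h2.
have st1 : N s <= t.
  have -> : s = (s - s0) + s0 by rewrite subrK.
  by apply: le_trans (cs_normD _ _) _; lra.
split=> //.
have -> : sqrt_iter (rs 2^-1) y n.+2 - s = rs 2^-1 * ((s - s0) * (s + s0)).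
  rewrite [LHS](_ : _ = rs 2^-1 * (y + s * s) - rs 2^-1 * (y + s0 * s0)) //.
  by ring.
have -> : sqrt_iter 2^-1 1 n.+2 - t = 2^-1 * ((t - t0) * (t + t0)).
  rewrite [LHS](_ : _ = 2^-1 * (1 + t * t) - 2^-1 * (1 + t0 * t0)) //.
  by ring.
apply: le_trans (half_le _) _; rewrite ler_pM2l; last by lra.
apply: le_trans (cs_normM _ _) _; apply: ler_pM; rewrite ?cs_norm_ge0 //.
by apply: le_trans (cs_normD _ _) _; lra.
Qed.

Lemma sqrt_iter_cauchy y : N y <= 1 -> forall e, 0 < e ->
  exists n, forall m k, (n <= m)%N -> (n <= k)%N ->
    N (sqrt_iter (rs 2^-1) y m - sqrt_iter (rs 2^-1) y k) <= e.
Proof.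
move=> y1 e e0; set s := sqrt_iter (rs _) y; set t := sqrt_iter (2^-1 : R) 1.
have t_mono : {homo t : m n / (m <= n)%N >-> m <= n}.
  by apply/nondecreasing_seqP => n; have [/andP[]] := sqrt_iter_bounds n.
have st_le m k : N (s (m + k)%N - s m) <= t (m + k)%N - t m.
  elim: k => [|k IH]; first by rewrite addn0 !subrr cs_norm0.
  rewrite addnS; have [_ h] := sqrt_iter_le (m + k) y1.
  have -> : s (m + k).+1 - s m =
      (s (m + k).+1 - s (m + k)%N) + (s (m + k)%N - s m).
    by ring.
  by apply: le_trans (cs_normD _ _) _; move: h IH; rewrite -/s -/t; lra.
have /cvg_ex[l tl] : cvgn t.
  apply: nondecreasing_is_cvgn => //; exists 1 => _ [n _ <-].
  by have [] := sqrt_iter_bounds n.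
have /cvgrPdist_le/(_ _ e0) [n _ Hn] := tl.
have t_le_l m : t m <= l.
  rewrite -(cvg_lim _ tl) //; apply: nondecreasing_cvgn_le => //.
  by apply/cvg_ex; exists l.
have H m k : (n <= m)%N -> (m <= k)%N -> N (s k - s m) <= e.
  move=> nm mk; rewrite -(subnKC mk); apply: le_trans (st_le _ _) _.
  have := Hn m nm; rewrite /= ger0_norm ?subr_ge0 //.
  by have := t_le_l (m + (k - m))%N; lra.
exists n => m k nm nk; case: (leqP k m) => [|/ltnW] km; first exact: H.
by rewrite -opprB cs_normN; exact: H.
Qed.

Lemma cs_sqrt y : st y = y -> N y <= 1 -> exists s, st s = s /\ s * s = 1 - y.
Proof.
move=> sty y1; have [l Hl] := cs_complete (sqrt_iter_cauchy y1).
set s := sqrt_iter _ _ in Hl.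
have sts n : st (s n) = s n.
  rewrite /s; elim: n => [|n IH] /=; first by rewrite rmorph0.
  by rewrite rmorphM rmorphD rmorphM sty IH cs_star_real.
have sn1 n : N (s n) <= 1.
  have [h _] := sqrt_iter_le n y1; apply: le_trans h _.
  by have [] := sqrt_iter_bounds n.
have stl : st l = l.
  apply/eqP; rewrite -subr_eq0; apply/eqP/cs_norm_le0 => e e0.
  have e2 : 0 < e / 2 by rewrite divr_gt0.
  have [n /(_ _ (leqnn n)) Hn] := Hl _ e2.
  have -> : st l - l = st (- (s n - l)) + (s n - l).
    by rewrite rmorphN rmorphB sts; ring.
  by apply: le_trans (cs_normD _ _) _; rewrite cs_norm_stE cs_normN; lra.
have lE : l = rs 2^-1 * (y + l * l).
  apply/eqP; rewrite -subr_eq0; apply/eqP/cs_norm_le0 => e e0.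
  pose d := Num.min (e / 3) 1.
  have d0 : 0 < d by rewrite lt_min ltr01 andbT divr_gt0.
  have d1 : d <= 1 by rewrite ge_min lexx orbT.
  have de : d <= e / 3 by rewrite ge_min lexx.
  have [n Hn] := Hl _ d0.
  have h1 := Hn _ (leqnSn n); have h2 := Hn _ (leqnn n).
  have -> : l - rs 2^-1 * (y + l * l) =
     - (s n.+1 - l) + rs 2^-1 * ((s n - l) * (s n - l + l + l)).
    have -> : s n.+1 = rs 2^-1 * (y + s n * s n) by [].
    have -> : s n - l + l + l = s n + l by ring.
    by ring.
  apply: le_trans (cs_normD _ _) _; rewrite cs_normN.
  have h3 : N (s n - l + l + l) <= 1 + 2.
    have -> : s n - l + l + l = s n + s n - (s n - l) by ring.
    apply: le_trans (cs_normD _ _) _; rewrite cs_normN.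
    have := cs_normD (s n) (s n); have := sn1 n; lra.
  have h4 : N (rs 2^-1 * ((s n - l) * (s n - l + l + l))) <= 2^-1 * (d * 3).
    apply: le_trans (cs_normM _ _) _; apply: ler_pM; rewrite ?cs_norm_ge0 //.
      by apply: le_trans (cs_norm_real _) _; rewrite ger0_norm //; lra.
    apply: le_trans (cs_normM _ _) _.
    by apply: ler_pM; rewrite ?cs_norm_ge0 //; lra.
  by have := lerD h1 h4; lra.
exists (1 - l); split; first by rewrite rmorphB rmorph1 stl.
have l2 : l + l = y + l * l.
  rewrite {1 2}lE -mulrDl half_add_half; ring.
have -> : (1 - l) * (1 - l) = 1 - (l + l) + l * l by ring.
by rewrite l2; ring.
Qed.

(** The element [z = a + i b] is normal with [z* z = a ^ 2 + b ^ 2], and [a] is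
    the mean of [z] and [z*]. *)
Lemma cs_norm_sq_le a b : st a = a -> st b = b -> N a ^+ 2 <= N (a * a + b * b).
Proof.
move=> sa sb; pose z := a + sc 'i * b.
have sz : st z = a - sc 'i * b.
  by rewrite rmorphD rmorphM sa sb cs_star_scal conjCi rmorphN mulNr.
have ii : sc 'i * sc 'i = -1 by rewrite -rmorphM -expr2 sqrCi rmorphN1.
have -> : a * a + b * b = st z * z.
  rewrite sz /z; transitivity (a * a - sc 'i * sc 'i * (b * b)); last by ring.
  by rewrite ii; ring.
rewrite cs_norm_star ler_pXn2r ?nnegrE ?cs_norm_ge0 //.
have -> : a = rs 2^-1 * (st z + z).
  rewrite sz (_ : a - _ + _ = a + a); last by rewrite /z; ring.
  by rewrite mulrDr -mulrDl half_add_half mul1r.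
apply: le_trans (cs_normM _ _) _.
have := cs_normD (st z) z; rewrite cs_norm_stE => h.
have := cs_norm_real 2^-1; rewrite ger0_norm ?invr_ge0 // => h2.
apply: le_trans (ler_pM (cs_norm_ge0 _) (cs_norm_ge0 _) h2 h) _; lra.
Qed.

(** Write [1 - a ^ 2 = s ^ 2], and suppose [m = (1 - a ^ 2) d] close to [1].  For
    a real [dl > 0] so small that [1 - dl e* e] is a square [r ^ 2], where
    [e = s d], one gets [a ^ 2 + (r s) ^ 2 = 1 - dl m* m].  Its norm is less
    than [1], hence so is the norm of [a], by [cs_norm_sq_le]. *)
Lemma norm_one_not_invertible a d : st a = a -> N a = 1 ->
  8^-1 < N (1 - (1 - a * a) * d).
Proof.
move=> sa a1; rewrite ltNge; apply/negP; set m := (1 - a * a) * d => m1.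
have [||s [ss s2]] := @cs_sqrt (a * a); first by rewrite rmorphM sa.
  by apply: le_trans (cs_normM _ _) _; rewrite a1 mulr1.
pose e := s * d; pose p := N e ^+ 2; pose dl := (1 + p)^-1.
have p0 : 0 <= p by exact: sqr_ge0.
have dl0 : 0 < dl by rewrite invr_gt0; lra.
have dlE : dl * (1 + p) = 1 by rewrite mulVf // gt_eqF // ltr_pwDl.
have dl1 : dl <= 1 by nra.
have [||r [sr r2]] := @cs_sqrt (rs dl * (st e * e)).
- by rewrite rmorphM rmorphM cs_starK cs_star_real (mulrC e).
- apply: le_trans (cs_normM _ _) _; rewrite cs_norm_star -/p.
  have := cs_norm_real dl; rewrite gtr0_norm // => h.
  by apply: (@le_trans _ _ (dl * p)); [rewrite ler_wpM2r|lra].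
pose M := 1 - st m * m.
have NM : N M <= 17 / 64.
  have -> : M = (1 - m) + (st (1 - m) - st (1 - m) * (1 - m)).
    by rewrite /M rmorphB rmorph1; ring.
  apply: le_trans (cs_normD _ _) _.
  have := cs_normD (st (1 - m)) (- (st (1 - m) * (1 - m))).
  rewrite cs_normN cs_norm_star cs_norm_stE.
  by have := cs_norm_ge0 (1 - m); nra.
have sqE : a * a + (r * s) * (r * s) = rs (1 - dl) + rs dl * M.
  rewrite rmorphB rmorph1 rmorphB rmorph1.
  transitivity (a * a + (r * r) * (s * s)); first by ring.
  have -> : M = 1 - st e * e * (1 - a * a).
    rewrite /M /m /e -s2 !rmorphM ss; ring.
  by rewrite r2 s2; ring.
have := @cs_norm_sq_le a (r * s) sa; rewrite rmorphM sr ss sqE a1 expr1n.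
move=> /(_ erefl); apply/negP; rewrite -ltNge.
apply: le_lt_trans (cs_normD _ _) _.
have h1 := cs_norm_real (1 - dl); rewrite ger0_norm ?subr_ge0 // in h1.
have h2 := cs_norm_real dl; rewrite gtr0_norm // in h2.
have h3 := ler_pM (cs_norm_ge0 _) (cs_norm_ge0 _) h2 NM.
have h4 := cs_normM (rs dl) M; nra.
Qed.

(** Asking that an ideal keep a distance from [1], rather than avoid it, gives
    a condition that passes to unions of chains and makes [1] stay outside the
    closure without a Neumann series.  The value [1/8] matters only through
    [(2 d + d ^ 2) ^ 2 <= d]. *)
Record far_ideal (J : set B) : Prop := FarIdeal {
  far0 : J 0;
  farD : forall x y, J x -> J y -> J (x + y);
  farM : forall x y, J x -> J (x * y);
  far1 : forall x, J x -> 8^-1 < N (1 - x) }.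

(** A maximal such ideal is prime: if [x] and [y] are outside [J], then both
    [J + x B] and [J + y B] come within [1/8] of [1], so a product of two of
    their elements comes within [17/64], and it lies in [J] if [x * y] does.
    Squaring the difference to [1] goes back below [1/8]. *)
Lemma exists_prime_far_ideal t : (forall d, 8^-1 < N (1 - t * d)) ->
  exists J, [/\ far_ideal J, J t & forall x y, J (x * y) -> J x \/ J y].
Proof.
(* [set0] is the union of the empty chain. *)
move=> t1; pose P (J : set B) := J = set0 \/ (far_ideal J /\ J t).
have princ : P [set t * d | d in setT].
  right; split; last by exists 1; rewrite ?mulr1.
  split.
  - by exists 0; rewrite ?mulr0.
  - by move=> _ _ [x _ <-] [y _ <-]; exists (x + y); rewrite ?mulrDr.
  - by move=> _ y [x _ <-]; exists (x * y); rewrite ?mulrA.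
  - by move=> _ [x _ <-]; exact: t1.
have [F FP Ftot|J [PJ Jmax]] := @Zorn_bigcup B P.
  have [[J0 [FJ0 J0t]]|Fno] := pselect (exists J0, F J0 /\ J0 t); last first.
    left; rewrite -subset0 => x [J FJ Jx].
    have [J0|[_ Jt]] := FP _ FJ; first by rewrite J0 in Jx.
    by case: Fno; exists J.
  have FI J x : F J -> J x -> far_ideal J.
    by move=> FJ Jx; have [J0'|[//]] := FP _ FJ; rewrite J0' in Jx.
  right; split; last by exists J0.
  split.
  - by exists J0 => //; apply: far0; exact: FI J0t.
  - move=> x y [J1 FJ1 J1x] [J2 FJ2 J2y].
    have [J12|J21] := Ftot _ _ FJ1 FJ2.
      by exists J2 => //; apply: farD => //; [exact: FI J2y|exact: J12].
    by exists J1 => //; apply: farD => //; [exact: FI J1x|exact: J21].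
  - by move=> x y [J1 FJ1 J1x]; exists J1 => //; apply: farM => //; exact: FI J1x.
  - by move=> x [J1 FJ1 J1x]; apply: (far1 _ J1x); exact: FI J1x.
have [FJ Jt] : far_ideal J /\ J t.
  case: PJ => // J0; case: (Jmax _ _ princ); rewrite J0; split=> // /(_ t).
  by apply; exists 1; rewrite ?mulr1.
exists J; split=> // x y Jxy; apply/or_asboolP/negPn/negP; rewrite negb_or.
move=> /andP[/asboolP nJx /asboolP nJy].
have adj z : ~ J z -> exists j b, J j /\ N (1 - (j + z * b)) <= 8^-1.
  move=> nJz; apply: contrapT => no.
  pose K := [set j + z * b | j in J & b in setT].
  have /Jmax : J `<` K; last first.
    apply; right; split; last by exists t => //; exists 0; rewrite ?mulr0 ?addr0.
    split.
    - by exists 0; [exact: far0|exists 0; rewrite ?mulr0 ?addr0].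
    - move=> _ _ [j1 J1 [b1 _ <-]] [j2 J2 [b2 _ <-]].
      by exists (j1 + j2); [exact: farD|exists (b1 + b2) => //; ring].
    - move=> _ w [j1 J1 [b1 _ <-]].
      by exists (j1 * w); [exact: farM|exists (b1 * w) => //; ring].
    - move=> _ [j1 J1 [b1 _ <-]]; rewrite ltNge; apply/negP => h.
      by apply: no; exists j1, b1.
  split; first by move=> j Jj; exists j => //; exists 0; rewrite ?mulr0 ?addr0.
  move=> /(_ z) KJ; apply/nJz/KJ; exists 0; first exact: far0.
  by exists 1; rewrite ?mulr1 ?add0r.
have [j1 [b1 [J1 h1]]] := adj _ nJx; have [j2 [b2 [J2 h2]]] := adj _ nJy.
set u := 1 - _ in h1; set v := 1 - _ in h2.
pose w := u + v - u * v.
have Nw : N w <= 17 / 64.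
  apply: le_trans (cs_normD _ _) _; rewrite cs_normN.
  have := cs_normD u v; have := cs_normM u v.
  by have := cs_norm_ge0 u; have := cs_norm_ge0 v; nra.
have Jw : J (1 - w).
  have -> : 1 - w = j1 * (j2 + y * b2) + j2 * (x * b1) + x * y * (b1 * b2).
    by rewrite /w /u /v; ring.
  by apply: farD => //; [apply: farD => //|]; exact: farM.
have := far1 FJ (farM FJ (1 + w) Jw); apply/negP; rewrite -leNgt.
have -> : 1 - (1 - w) * (1 + w) = w * w by ring.
by apply: le_trans (cs_normM _ _) _; have := cs_norm_ge0 w; nra.
Qed.

Definition near_ideal (J : set B) (x : B) : Prop :=
  forall e, 0 < e -> exists2 j, J j & N (x - j) <= e.

Lemma near_idealD J x y : far_ideal J ->
  near_ideal J x -> near_ideal J y -> near_ideal J (x + y).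
Proof.
move=> FJ Jx Jy e e0; have e2 : 0 < e / 2 by rewrite divr_gt0.
have [j Jj hj] := Jx _ e2; have [k Jk hk] := Jy _ e2.
exists (j + k); first exact: farD.
have -> : x + y - (j + k) = (x - j) + (y - k) by ring.
by apply: le_trans (cs_normD _ _) _; lra.
Qed.

Lemma near_idealM J x y : far_ideal J ->
  near_ideal J x -> near_ideal J (x * y).
Proof.
move=> FJ Jx e e0.
have [|j Jj hj] := Jx (e / (1 + N y)).
  by rewrite divr_gt0 // ltr_pwDl ?cs_norm_ge0.
exists (j * y); first exact: farM.
rewrite -mulrBl; apply: le_trans (cs_normM _ _) _.
apply: le_trans (ler_wpM2r (cs_norm_ge0 _) hj) _.
by rewrite mulrAC ler_pdivrMr ?ltr_pwDl ?cs_norm_ge0 // ler_pM2l // lerDr.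
Qed.

Lemma near_ideal_scal J c : far_ideal J -> near_ideal J (sc c) -> c = 0.
Proof.
move=> FJ Jc; apply/eqP/negPn/negP => c0.
have := near_idealM (sc c^-1) FJ Jc; rewrite -rmorphM divff // rmorph1.
move=> /(_ 8^-1)[//|j Jj]; apply/negP; rewrite -ltNge; exact: far1 Jj.
Qed.

(** Normalize [T* T] to a self-adjoint [a] of norm [1].  The element [1 - a ^ 2]
    generates an ideal far from [1]; modulo a prime ideal containing it [a] is a
    square root of [1].  So if [T] is congruent to [c] and [T*] to the
    conjugate of [c], then [|c| ^ 4 = |T| ^ 4]. *)
Lemma prime_ideal_attains_norm T : 0 < N T ->
  exists J : set B, [/\ far_ideal J, forall x y, J (x * y) -> J x \/ J y &
    forall c, near_ideal J (T - sc c) -> near_ideal J (st T - sc c^*) ->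
      nrm c = N T].
Proof.
move=> T0; pose a := rs (N T ^- 2) * (st T * T).
have sa : st a = a by rewrite /a !rmorphM cs_star_real cs_starK (mulrC T).
have Na : N a = 1.
  have T2 : 0 < N T ^- 2 by rewrite invr_gt0 exprn_gt0.
  have le1 : N a <= 1.
    apply: le_trans (cs_normM _ _) _.
    apply: le_trans (ler_wpM2r (cs_norm_ge0 _) (cs_norm_real _)) _.
    by rewrite cs_norm_star gtr0_norm // mulVf // expf_neq0 // gt_eqF.
  apply/eqP; rewrite eq_le le1 /=.
  have : st T * T = rs (N T ^+ 2) * a.
    rewrite /a mulrA -rmorphM -rmorphM /= divff ?expf_neq0 ?gt_eqF //.
    by rewrite !rmorph1 mul1r.
  move=> /(congr1 N); rewrite cs_norm_star => E.
  have := cs_normM (rs (N T ^+ 2)) a; rewrite -E => h.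
  have := cs_norm_real (N T ^+ 2); rewrite ger0_norm ?sqr_ge0 // => h2.
  have h3 := le_trans h (ler_wpM2r (cs_norm_ge0 _) h2).
  by move: h3; rewrite ler_pMr // exprn_gt0.
have [J [FJ Jt Jp]] :=
  exists_prime_far_ideal (fun d => norm_one_not_invertible d sa Na).
exists J; split=> // c Tc sTc.
pose q := (((N T ^- 2)%:C)%C * (c^* * c)) : R[i].
have aq : near_ideal J (sc q - a).
  have -> : sc q - a = (T - sc c) * (- (rs (N T ^- 2) * sc c^*)) +
      (st T - sc c^*) * (- (rs (N T ^- 2) * T)).
    by rewrite /q /a !rmorphM; ring.
  by apply: near_idealD => //; exact: near_idealM.
have : near_ideal J (sc (1 - q * q)).
  have -> : sc (1 - q * q) = (1 - a * a) + (sc q - a) * (- (sc q + a)).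
    by rewrite rmorphB rmorph1 rmorphM; ring.
  apply: near_idealD => //; last exact: near_idealM.
  by move=> e e0; exists (1 - a * a) => //; rewrite subrr cs_norm0 ltW.
move=> /(near_ideal_scal FJ)/eqP; rewrite subr_eq0 => /eqP q1.
have cE : c^* * c = ((nrm c ^+ 2)%:C)%C.
  by rewrite mulrC -normCK rmorphXn /=; congr (_ ^+ 2).
have qE : q = ((N T ^- 2 * nrm c ^+ 2)%:C)%C by rewrite /q cE -rmorphM.
have /eqP : N T ^- 2 * nrm c ^+ 2 * (N T ^- 2 * nrm c ^+ 2) = 1.
  by move: q1; rewrite qE -rmorphM => /= /(congr1 (@complex.Re R)) /= <-.
have nc0 : 0 <= nrm c by rewrite /nrm normc_def /= sqrtr_ge0.
rewrite -expr2 sqrf_eq1 => /orP[|] /eqP h.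
  have : nrm c ^+ 2 = N T ^+ 2.
    by rewrite -[LHS](mulVKf (x := N T ^+ 2)) ?h ?mulr1 // expf_neq0 // gt_eqF.
  by move/eqP; rewrite eqrXn2 ?cs_norm_ge0 // => /eqP.
have : 0 <= N T ^- 2 * nrm c ^+ 2 by rewrite mulr_ge0 ?invr_ge0 ?sqr_ge0.
by rewrite h ler0N1.
Qed.

End CommutativeCStar.

(** * Bump functions and dense subalgebras of C(Y) *)

(** If the conclusion fails, the complements of the sets satisfying [Q] form a
    proper filter on [K], and [Q] fails near any of its cluster points.  This
    packages the passage from a finite subcover to a sum or product over it. *)
Lemma compact_induction (T : topologicalType) (K : set T) (Q : set T -> Prop) :
  compact K -> Q set0 -> (forall A B, A `<=` B -> Q B -> Q A) ->
  (forall A B, Q A -> Q B -> Q (A `|` B)) ->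
  (forall x, K x -> exists2 U, nbhs x U & Q U) -> Q K.
Proof.
move=> cK Q0 Qsub QU Qloc; apply: contrapT => nQK.
pose F : set_system T := [set A | Q (K `\` A)].
have FF : ProperFilter F.
  split; first by rewrite /F /= setD0.
  split.
  - by rewrite /F /= setDT.
  - by move=> A B FA FB; rewrite /F /= setDIr; exact: QU.
  - by move=> A B AB; apply: Qsub; exact: setDS.
have [|x [Kx clx]] := cK F FF; first by rewrite /F /= setDv.
have [U Ux QUx] := Qloc x Kx.
have [||z [nUz Uz]] := clx (~` U) U => //.
by apply: (Qsub _ _ _ QUx); rewrite setDE setCK; exact: subIsetr.
Qed.

Section Bumps.
Context (R : realType).
Local Notation C := (complexField R).

Lemma cont_addE (Y : CHaus) (u v : cont_alg C Y) z :
  (u + v : cont_alg C Y) z = u z + v z.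
Proof. by []. Qed.

Lemma cont_mulE (Y : CHaus) (u v : cont_alg C Y) z :
  (smul u v : cont_alg C Y) z = u z * v z.
Proof. by []. Qed.

Lemma real_complex_continuous : continuous (fun r : R => (r%:C)%C : C).
Proof.
move=> r; apply/(@cvgrPdist_lt _ C^o) => e e0.
have e0' : 0 < complex.Re e by move: e0; rewrite ltcE => /andP[].
have eE : e = ((complex.Re e)%:C)%C by rewrite RRe_real // gtr0_real.
near=> s; rewrite -rmorphB /= normc_def /= expr0n addr0 sqrtr_sqr eE ltcR.
by near: s; apply: (@cvgr_dist_lt _ R^o) => //; exact: cvg_id.
Unshelve. all: by end_near. Qed.

Lemma urysohn_CHaus (Y : CHaus) (A B : set Y) :
  closed A -> closed B -> A `&` B = set0 ->
  exists phi : cont_alg C Y, [/\ forall z, 0 <= phi z <= 1,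
    forall z, A z -> phi z = 1 & forall z, B z -> phi z = 0].
Proof.
move=> cA cB AB.
have nY : normal_space (CHaus_space Y).
  by apply: compact_normal; [exact: CHaus_hausdorff|exact: CHaus_compact].
have sep : uniform_separator B A.
  by apply: ((@normal_separatorP R (CHaus_space Y)).1 nY) => //; rewrite setIC.
pose phi (y : Y) : C := ((Urysohn B A y : R)%:C)%C.
have cphi : continuous phi.
  move=> y; apply: (continuous_comp (f := Urysohn B A)).
    exact: Urysohn_continuous.
  exact: real_complex_continuous.
exists (cont_mk cphi); split=> z.
- have : `[0, 1]%classic (Urysohn (R := R) B A z).
    by apply: (Urysohn_range (A := B) (B := A)); exists z.
  by rewrite /= in_itv /= /phi -(lecR 0) -[X in _ && X](lecR _ 1).
- move=> Az; have E : Urysohn B A z = 1 :> R.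
    by apply: (Urysohn_sub1 (R := R) sep); exists z.
  exact: (congr1 (fun r : R => (r%:C)%C) E).
- move=> Bz; have E : Urysohn B A z = 0 :> R.
    by apply: (Urysohn_sub0 (R := R) sep); exists z.
  exact: (congr1 (fun r : R => (r%:C)%C) E).
Qed.

Lemma bump_function (Y : CHaus) (y : Y) (U : set Y) : nbhs y U ->
  exists phi : cont_alg C Y, [/\ forall z, 0 <= phi z <= 1,
    \forall z \near y, phi z = 1 & forall z, ~ U z -> phi z = 0].
Proof.
move=> Uy; have [||||W Wy WU] := @compact_regular Y y setT _ _ _ U^°.
- exact: CHaus_hausdorff.
- exact: CHaus_compact.
- exact: filterT.
- exact: nbhs_interior.
have [|||phi [p01 p1 p0]] := @urysohn_CHaus Y (closure W) (~` U^°).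
- exact: closed_closure.
- by apply: open_closedC; exact: open_interior.
- by apply/disjoints_subset; rewrite setCK.
exists phi; split=> //.
- by apply: filterS Wy => z Wz; apply: p1; exact: subset_closure.
- by move=> z nUz; apply: p0 => /interior_subset.
Qed.

Section Density.
Context (Y : CHaus) (J : Type) (Z : J -> CHaus) (g : cone Y Z).
Context (D : set (cont_alg C Y)).
Context (g_sep : separates_points g).
Context (D_cst : forall c, D (ccst Y c)).
Context (D_add : forall u v, D u -> D v -> D (u + v)).
Context (D_mul : forall u v, D u -> D v -> D (smul u v)).
Context (D_gen : forall j (h : cont_alg C (Z j)), D (cont_comp (g j) h)).

(** Points of the complement of [U] are separated from [y] by bump functions
    pulled back from some [Z j]; compactness needs a product of finitely many.
    *)
Lemma subalgebra_bump (y : Y) (U : set Y) : nbhs y U ->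
  exists2 phi, D phi & [/\ forall z, 0 <= phi z <= 1,
    \forall z \near y, phi z = 1 & forall z, ~ U z -> phi z = 0].
Proof.
move=> Uy.
pose Q (S : set Y) := exists2 phi, D phi & [/\ forall z, 0 <= phi z <= 1,
    \forall z \near y, phi z = 1 & forall z, S z -> phi z = 0].
suff [phi Dphi [p01 p1 p0]] : Q (~` U^°).
  by exists phi => //; split=> // z nUz; apply: p0 => /interior_subset.
apply: compact_induction.
- apply: (subclosed_compact _ (@CHaus_compact Y)) => //.
  by apply: open_closedC; exact: open_interior.
- by exists (ccst Y 1) => //; split=> [z||z []]; [rewrite ler01 lexx|exact: filterE].
- move=> A B AB [phi Dphi [p01 p1 p0]]; exists phi => //.
  by split=> // z /AB; exact: p0.
- move=> A B [phi Dphi [p01 p1 p0]] [psi Dpsi [q01 q1 q0]].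
  exists (smul phi psi); first exact: D_mul.
  split=> [z||z].
  + have /andP[a b] := p01 z; have /andP[c d] := q01 z.
    by rewrite cont_mulE mulr_ge0 // mulr_ile1.
  + by near=> z; rewrite cont_mulE (near p1 z) // (near q1 z) // mulr1.
  + rewrite cont_mulE.
    by case=> [/p0|/q0] ->; rewrite ?mul0r ?mulr0.
- move=> z nUz.
  have yz : y <> z.
    move=> yz; apply: nUz; rewrite -yz.
    exact: nbhs_singleton (nbhs_interior _).
  have [j gyz] : exists j, g j y <> g j z.
    apply: contrapT => no; apply/yz/g_sep => j.
    by apply: contrapT => ?; apply: no; exists j.
  have := @CHaus_hausdorff (Z j); rewrite open_hausdorff => /(_ (g j y) (g j z)).
  move=> /(_ (introN eqP gyz)) [[U1 U2]] /= [/set_mem U1y /set_mem U2z].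
  move=> [oU1 oU2 U12].
  have [|h [h01 h1 h0]] := @bump_function (Z j) (g j y) U1.
    exact: open_nbhs_nbhs.
  have gc : continuous (g j) by exact: cts_fun.
  exists (g j @^-1` U2).
    by apply: gc; apply: open_nbhs_nbhs.
  exists (cont_comp (g j) h) => //; split => [x||x U2x].
  + exact: h01.
  + exact: (gc y _ h1).
  + by apply: h0 => U1x; have : (U1 `&` U2) (g j x) by []; rewrite (eqP U12).
Unshelve. all: by end_near. Qed.

(** A partition of unity built inside [D] without the lattice operations of
    the Stone-Weierstrass argument: on the union of two pieces, the function
    [p + (1 - p) q] replaces a maximum. *)
Lemma subalgebra_dense (u : cont_alg C Y) (e : C) : 0 < e ->
  exists2 v, D v & forall y, `|v y - u y| <= e.
Proof.
move=> e0.
pose Q (S : set Y) := exists p v : cont_alg C Y,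
  [/\ D p, D v, forall z, 0 <= p z <= 1, forall z, S z -> p z = 1 &
      forall z, `|v z - u z * p z| <= e * p z].
suff [p [v [Dp Dv _ p1 pv]]] : Q [set: Y].
  by exists v => // y; have := pv y; rewrite p1 // !mulr1.
apply: (compact_induction (@CHaus_compact Y)).
- exists (ccst Y 0), (ccst Y 0); split=> //= z; first by rewrite lexx ler01.
  by rewrite !mulr0 subr0 normr0.
- move=> A B AB [p [v [Dp Dv p01 p1 pv]]]; exists p, v; split=> // z /AB; exact: p1.
- move=> A B [p [v [Dp Dv p01 p1 pv]]] [q [w [Dq Dw q01 q1 qw]]].
  pose r := (ccst Y 1 + smul (ccst Y (-1)) p : cont_alg C Y).
  have Dr : D r by apply: D_add => //; exact: D_mul.
  have rE z : r z = 1 - p z by rewrite cont_addE cont_mulE mulN1r.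
  exists (p + smul r q), (v + smul r w); split.
  + by apply: D_add => //; exact: D_mul.
  + by apply: D_add => //; exact: D_mul.
  + move=> z; rewrite cont_addE cont_mulE rE.
    have /andP[a b] := p01 z; have /andP[c d] := q01 z.
    rewrite addr_ge0 ?mulr_ge0 ?subr_ge0 //= -subr_ge0.
    rewrite (_ : 1 - _ = (1 - p z) * (1 - q z)); last by ring.
    by rewrite mulr_ge0 ?subr_ge0.
  + move=> z; rewrite cont_addE cont_mulE rE => -[/p1|/q1] ->; ring.
  + move=> z; rewrite !cont_addE !cont_mulE rE.
    have /andP[a b] := p01 z.
    rewrite (_ : v z + _ - _ = (v z - u z * p z) +
      (1 - p z) * (w z - u z * q z)); last by ring.
    apply: le_trans (ler_normD _ _) _; rewrite [leRHS]mulrDr lerD //.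
    rewrite normrM ger0_norm ?subr_ge0 //.
    by rewrite mulrCA ler_wpM2l ?subr_ge0.
- move=> y _; have uc : \forall z \near y, `|u y - u z| < e.
    by have /(@cvgrPdist_lt _ C^o)/(_ _ e0) := @cont_continuous _ _ u y.
  have [phi Dphi [p01 p1 p0]] := subalgebra_bump uc.
  exists [set z | phi z = 1] => //.
  exists phi, (smul (ccst Y (u y)) phi); split=> //; first exact: D_mul.
  move=> z; rewrite cont_mulE -mulrBl normrM.
  have /andP[a _] := p01 z; rewrite (ger0_norm a).
  have [uz|/p0 ->] := pselect (`|u y - u z| < e); last by rewrite !mulr0.
  by rewrite ler_wpM2r // ltW.
Qed.

End Density.
End Bumps.

(** * Contractivity of star-homomorphisms on C(X) *)

Section CStarBasics.
Context (R : realType).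
Local Notation C := (complexField R).
Context (A : cstarAlgType C).
Implicit Types x y z : A.

Lemma smul0l x : smul 0 x = 0.
Proof. by apply: (@addrI _ (smul 0 x)); rewrite -smulDl !addr0. Qed.

Lemma smul0r x : smul x 0 = 0.
Proof. by apply: (@addrI _ (smul x 0)); rewrite -smulDr !addr0. Qed.

Lemma smulNl x y : smul (- x) y = - smul x y.
Proof. by apply: (@addrI _ (smul x y)); rewrite -smulDl !subrr smul0l. Qed.

Lemma smulNr x y : smul x (- y) = - smul x y.
Proof. by apply: (@addrI _ (smul x y)); rewrite -smulDr !subrr smul0r. Qed.

Lemma star0 : star (0 : A) = 0.
Proof. by apply: (@addrI _ (star 0)); rewrite -starD !addr0. Qed.

Lemma starN x : star (- x) = - star x.
Proof. by apply: (@addrI _ (star x)); rewrite -starD !subrr star0. Qed.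

Lemma star1 : star (sone : A) = sone.
Proof.
transitivity (star (smul sone (star (sone : A)))).
  by rewrite starM starK smul1l.
by rewrite smul1l starK.
Qed.

Lemma nrmM x y : nrm (smul x y) <= nrm x * nrm y.
Proof. by rewrite -lecR rmorphM /= !nrmE; exact: cstar_normM. Qed.

Lemma nrm_star_mul x : nrm (smul (star x) x) = nrm x ^+ 2.
Proof.
apply: (@complexI R); rewrite rmorphXn /= !nrmE; exact: cstar_norm_star.
Qed.

Lemma nrm_star x : nrm (star x) = nrm x.
Proof.
have le_star y : nrm y <= nrm (star y).
  have [->|y0] := eqVneq (nrm y) 0; first exact: nrm_ge0.
  have := nrmM (star y) y; rewrite nrm_star_mul expr2 ler_pM2r //.
  by rewrite lt_neqAle eq_sym y0 nrm_ge0.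
by apply/eqP; rewrite eq_le le_star andbT -{2}[x]starK le_star.
Qed.

Lemma nrmZ (c : C) x : nrm (c *: x) = nrm c * nrm x.
Proof. by apply: (@complexI R); rewrite rmorphM /= !nrmE normrZ. Qed.

Lemma nrm_unitary x : smul (star x) x = sone -> nrm x <= 1.
Proof.
move=> xu; have := nrm_star_mul sone; rewrite star1 smul1l => h1.
have := nrm_star_mul x; rewrite xu => h2.
have n1 : nrm (sone : A) <= 1 by nra.
by nra.
Qed.

End CStarBasics.

Section Contraction.
Context (R : realType).
Local Notation C := (complexField R).

Lemma Re_continuous : continuous (@complex.Re R : C -> R).
Proof.
move=> z; apply/(@cvgrPdist_lt _ _ _ _ (nbhs_filter z)) => e e0.
have e0' : 0 < (e%:C)%C :> C by rewrite (ltcR 0).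
apply: filterS (nbhsx_ballx z _ e0') => w.
rewrite -ball_normE /ball_ /= -(ltcR _ e); apply: le_lt_trans.
by rewrite -raddfB; exact: normc_ge_Re.
Qed.

Lemma conj_re_im (F : numClosedFieldType) (a b : F) :
  a^* = a -> b^* = b -> (a + 'i * b)^* = a - 'i * b.
Proof. by move=> ca cb; rewrite rmorphD rmorphM /= conjCi ca cb mulNr. Qed.

Lemma cont_sqrt_compl (X : CHaus) (v : cont_alg C X) :
  (forall x, 0 <= v x <= 1) ->
  exists s : cont_alg C X, forall x, (s x)^* = s x /\ s x * s x = 1 - v x * v x.
Proof.
move=> v01; pose s (x : X) : C := ((Num.sqrt (1 - complex.Re (v x) ^+ 2))%:C)%C.
have cRv : continuous (fun x : X => complex.Re (v x) : R).
  move=> x; apply: (continuous_comp (f := v)); first exact: cont_continuous.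
  exact: Re_continuous.
have cs : continuous s.
  move=> x.
  apply: (continuous_comp
    (f := fun x => Num.sqrt (1 - complex.Re (v x) ^+ 2))).
    apply: (continuous_comp (f := fun x => (1 - complex.Re (v x) ^+ 2))).
      by apply: cvgB; [exact: cvg_cst|apply: cvgM; exact: cRv].
    exact: sqrt_continuous.
  exact: real_complex_continuous.
exists (cont_mk cs) => x; split; first exact: conjc_real.
have /andP[v0 v1] := v01 x.
have vE : v x = ((complex.Re (v x))%:C)%C by rewrite RRe_real // ger0_real.
rewrite [LHS](_ : _ = s x * s x) // /s -rmorphM /= -expr2 sqr_sqrtr.
  by rewrite [in RHS]vE rmorphB rmorph1 rmorphXn /= expr2.
move: v0 v1; rewrite vE (lecR 0) (lecR _ 1) => v0 v1.
by rewrite subr_ge0 expr_le1.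
Qed.

Lemma starHom_cst (A : cstarAlgType C) (Z : CHaus)
    (a : starHom (cont_alg C Z) A) c : a (ccst Z c) = c *: sone.
Proof.
rewrite -(star_morph1 (s := a)) -linearZ; congr (a _); apply/cont_algP => z.
by symmetry; exact: mulr1.
Qed.

(** A function [v] with values in [0, 1] is the mean of the unitaries
    [v + i s] and [v - i s] for [s = sqrt (1 - v ^ 2)], and images of unitaries
    have norm at most [1].  The general case follows from the identity for the
    norm of [star u * u]. *)
Lemma starHom_contractive (A : cstarAlgType C) (X : CHaus)
    (a : starHom (cont_alg C X) A) (u : cont_alg C X) (c : R) :
  0 <= c -> (forall x, nrm (u x) <= c) -> nrm (a u) <= c.
Proof.
move=> c0 uc.
have unit_interval (v : cont_alg C X) : (forall x, 0 <= v x <= 1) -> nrm (a v) <= 1.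
  move=> v01; have [s Hs] := cont_sqrt_compl v01.
  pose w := v + 'i *: s : cont_alg C X.
  pose w' := v - 'i *: s : cont_alg C X.
  have sw : star w = w'.
    apply/cont_algP => x; have [sx _] := Hs x; have /andP[v0 _] := v01 x.
    rewrite [LHS](_ : _ = (v x + 'i * s x)^*) // [RHS](_ : _ = v x - 'i * s x) //.
    by apply: conj_re_im => //; apply/CrealP; exact: ger0_real.
  have ww : smul (star w) w = sone.
    apply/cont_algP => x; have [_ sx] := Hs x; rewrite sw.
    change ((v x - 'i * s x) * (v x + 'i * s x) = 1).
    have -> : (v x - 'i * s x) * (v x + 'i * s x) = v x * v x - 'i ^+ 2 * (s x * s x).
      by ring.
    by rewrite sqrCi sx; ring.
  have aw : nrm (a w) <= 1.
    by apply: nrm_unitary; rewrite -star_morphS -star_morphM ww star_morph1.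
  have aw' : nrm (a w') <= 1.
    rewrite -sw; apply: nrm_unitary.
    rewrite -star_morphS -star_morphM starK (_ : smul w _ = sone) ?star_morph1 //.
    by rewrite -ww; apply/cont_algP => x; exact: mulrC.
  have -> : v = 2^-1 *: (w + w').
    apply/cont_algP => x.
    change (v x = 2^-1 * ((v x + 'i * s x) + (v x - 'i * s x))).
    by field.
  rewrite linearZ linearD nrmZ.
  have -> : nrm (2^-1 : C) = 2^-1.
    rewrite (_ : 2^-1 = ((2^-1 : R)%:C)%C) ?nrm_real ?ger0_norm //.
    by rewrite fmorphV rmorph_nat.
  by have := nrmD (a w) (a w'); lra.
have [c0'|cn0] := eqVneq c 0.
  suff -> : u = 0 by rewrite raddf0 nrm0.
  apply/cont_algP => x; apply: nrm_eq0; apply/eqP.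
  by rewrite eq_le nrm_ge0 andbT -c0'.
have cp : 0 < c by rewrite lt_neqAle eq_sym cn0.
pose k : C := ((c ^- 2)%:C)%C.
have : nrm (a (k *: smul (star u) u)) <= 1.
  apply: unit_interval => x; have := uc x; rewrite nrm_le => ucx.
  rewrite [_ x](_ : _ = k * ((u x)^* * u x)) // mulrC -normCKC.
  have k0 : 0 <= k by rewrite (lecR 0) invr_ge0 sqr_ge0.
  rewrite mulr_ge0 ?exprn_ge0 //=.
  have -> : 1 = (((c%:C)%C : C) ^+ 2) * k.
    by rewrite /k -rmorphXn -rmorphM /= divff ?rmorph1 // expf_neq0.
  by rewrite ler_wpM2r // lerXn2r ?nnegrE // (lecR 0).
have -> : a (k *: smul (star u) u) = k *: smul (star (a u)) (a u).
  by rewrite linearZ; congr (_ *: _); rewrite -star_morphS -star_morphM.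
rewrite nrmZ nrm_star_mul.
have -> : nrm k = c ^- 2 by rewrite nrm_real ger0_norm // invr_ge0 sqr_ge0.
rewrite mulrC ler_pdivrMr ?exprn_gt0 // mul1r => h.
by move: h; rewrite ler_pXn2r ?nnegrE ?nrm_ge0.
Qed.
End Contraction.

(** * The bicommutant of a commuting family *)

Section Commutant.
Context (R : realType).
Local Notation C := (complexField R).
Context (A : cstarAlgType C).
Implicit Types (S : set A) (x y z : A).

Definition commutant S : set A := [set x | forall y, S y -> smul x y = smul y x].

Lemma commutant0 S : commutant S 0.
Proof. by move=> y _; rewrite smul0l smul0r. Qed.

Lemma commutant1 S : commutant S sone.
Proof. by move=> y _; rewrite smul1l smul1r. Qed.

Lemma commutantD S x y : commutant S x -> commutant S y -> commutant S (x + y).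
Proof. by move=> Sx Sy z Sz; rewrite smulDl smulDr Sx // Sy. Qed.

Lemma commutantN S x : commutant S x -> commutant S (- x).
Proof. by move=> Sx z Sz; rewrite smulNl smulNr Sx. Qed.

Lemma commutantM S x y : commutant S x -> commutant S y -> commutant S (smul x y).
Proof. by move=> Sx Sy z Sz; rewrite -smulA Sy // smulA Sx // -smulA. Qed.

Lemma commutantZ S (c : C) x : commutant S x -> commutant S (c *: x).
Proof. by move=> Sx z Sz; rewrite smulZl smulZr Sx. Qed.

Lemma commutant_star S x : (forall y, S y -> S (star y)) ->
  commutant S x -> commutant S (star x).
Proof.
by move=> Sst Sx z Sz; rewrite -[z]starK -!starM Sx //; exact: Sst.
Qed.

Lemma commutant_closed S x :
  (forall e : R, 0 < e -> exists2 y, commutant S y & nrm (y - x) <= e) ->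
  commutant S x.
Proof.
move=> Sx z Sz; apply: nrm_small => e e0.
have [|y Sy yx] := Sx (e / (2 * (1 + nrm z))).
  by rewrite divr_gt0 // mulr_gt0 // ltr_pwDl ?nrm_ge0.
have -> : smul x z - smul z x = smul z (y - x) - smul (y - x) z.
  rewrite smulDr smulDl smulNr smulNl (Sy z Sz) opprD opprK addrACA subrr add0r.
  by rewrite addrC.
apply: le_trans (nrmD _ _) _; rewrite nrmN.
have h1 := nrmM z (y - x); have h2 := nrmM (y - x) z.
have z0 := nrm_ge0 z; have d0 := nrm_ge0 (y - x).
have h3 : nrm (y - x) * (2 * (1 + nrm z)) <= e.
  by rewrite -ler_pdivlMr // mulr_gt0 // ltr_pwDl.
nra.
Qed.

End Commutant.

(** Bundled so that the instances on the bicommutant are indexed by a single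
    argument carrying the proof of commutativity. *)
Record starCommSet (R : realType)
    (A : cstarAlgType (complexField R)) :=
  StarCommSet {
    scs_set :> set A;
    scs_star : forall x, scs_set x -> scs_set (star x);
    scs_comm : forall x y, scs_set x -> scs_set y -> smul x y = smul y x }.

Section Bicommutant.
Context (R : realType).
Local Notation C := (complexField R).
Context (A : cstarAlgType C) (S : starCommSet A).

(** A commutative algebra because a commuting set is contained in its commutant,
    which the bicommutant therefore commutes with. *)
Definition bicomm : Type := {x : A | commutant (commutant S) x}.
HB.instance Definition _ := gen_eqMixin bicomm.
HB.instance Definition _ := gen_choiceMixin bicomm.

Lemma bicomm_eq (x y : bicomm) : sval x = sval y -> x = y.
Proof. by case: x y => x ? [y ?] /= xy; exact: eq_exist. Qed.

Lemma sub_bicomm : S `<=` commutant (commutant S).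
Proof. by move=> x Sx y Cy; rewrite Cy. Qed.

Lemma sub_commutant : S `<=` commutant S.
Proof. by move=> x Sx y Sy; exact: scs_comm Sx Sy. Qed.

Lemma bicomm_star x : commutant (commutant S) x -> commutant (commutant S) (star x).
Proof.
apply: commutant_star => y; apply: commutant_star; exact: scs_star.
Qed.

Definition bicomm0 : bicomm := exist _ 0 (@commutant0 _ _ _).
Definition bicomm1 : bicomm := exist _ sone (@commutant1 _ _ _).
Definition bicommD (x y : bicomm) : bicomm :=
  exist _ (sval x + sval y) (commutantD (svalP x) (svalP y)).
Definition bicommN (x : bicomm) : bicomm :=
  exist _ (- sval x) (commutantN (svalP x)).
Definition bicommM (x y : bicomm) : bicomm :=
  exist _ (smul (sval x) (sval y)) (commutantM (svalP x) (svalP y)).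
Definition bicomm_st (x : bicomm) : bicomm :=
  exist _ (star (sval x)) (bicomm_star (svalP x)).
Definition bicomm_sc (c : C) : bicomm :=
  exist _ (c *: sone) (commutantZ c (@commutant1 _ _ _)).

Let addA : associative bicommD.
Proof. by move=> x y z; apply/bicomm_eq; exact: addrA. Qed.
Let addC : commutative bicommD.
Proof. by move=> x y; apply/bicomm_eq; exact: addrC. Qed.
Let add0 : left_id bicomm0 bicommD.
Proof. by move=> x; apply/bicomm_eq; exact: add0r. Qed.
Let addN : left_inverse bicomm0 bicommN bicommD.
Proof. by move=> x; apply/bicomm_eq; exact: addNr. Qed.
HB.instance Definition _ := GRing.isZmodule.Build bicomm addA addC add0 addN.

Let mulA : associative bicommM.
Proof. by move=> x y z; apply/bicomm_eq; exact: smulA. Qed.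
Let mulC : commutative bicommM.
Proof.
move=> x y; apply/bicomm_eq; apply: (svalP x) => z Sz.
by apply: (svalP y) => w Sw; rewrite (sub_commutant Sz).
Qed.
Let mul1 : left_id bicomm1 bicommM.
Proof. by move=> x; apply/bicomm_eq; exact: smul1l. Qed.
Let mulD : left_distributive bicommM bicommD.
Proof. by move=> x y z; apply/bicomm_eq; exact: smulDl. Qed.
HB.instance Definition _ :=
  GRing.Zmodule_isComPzRing.Build bicomm mulA mulC mul1 mulD.

Let st_zmod : zmod_morphism bicomm_st.
Proof. by move=> x y; apply/bicomm_eq; rewrite /= starD starN. Qed.
Let st_monoid : monoid_morphism bicomm_st.
Proof.
split=> [|x y]; apply/bicomm_eq; rewrite /= ?star1 // starM.
have /(congr1 sval) := mulC (bicomm_st y) (bicomm_st x); exact.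
Qed.
HB.instance Definition _ :=
  GRing.isZmodMorphism.Build bicomm bicomm bicomm_st st_zmod.
HB.instance Definition _ :=
  GRing.isMonoidMorphism.Build bicomm bicomm bicomm_st st_monoid.

Let sc_zmod : zmod_morphism bicomm_sc.
Proof. by move=> x y; apply/bicomm_eq; rewrite /= scalerBl. Qed.
Let sc_monoid : monoid_morphism bicomm_sc.
Proof.
split=> [|x y]; apply/bicomm_eq; rewrite /= ?scale1r //.
by rewrite smulZl smul1l scalerA.
Qed.
HB.instance Definition _ :=
  GRing.isZmodMorphism.Build C bicomm bicomm_sc sc_zmod.
HB.instance Definition _ :=
  GRing.isMonoidMorphism.Build C bicomm bicomm_sc sc_monoid.

Definition bicomm_norm (x : bicomm) : R := nrm (sval x).

Let stK : involutive bicomm_st.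
Proof. by move=> x; apply/bicomm_eq; rewrite /= starK. Qed.
Let st_sc c : bicomm_st (bicomm_sc c) = bicomm_sc c^*.
Proof. by apply/bicomm_eq; rewrite /= starZ star1. Qed.
Let norm_eq0 x : bicomm_norm x = 0 -> x = 0.
Proof. by move=> /nrm_eq0 ?; apply/bicomm_eq. Qed.
Let norm_sc c : bicomm_norm (bicomm_sc c) <= nrm c.
Proof.
rewrite /bicomm_norm /= nrmZ -[leRHS]mulr1 ler_wpM2l ?nrm_ge0 //.
by apply: nrm_unitary; rewrite star1 smul1l.
Qed.
Let complete (u : nat -> bicomm) :
    (forall e, 0 < e -> exists n, forall m k, (n <= m)%N -> (n <= k)%N ->
      bicomm_norm (u m - u k) <= e) ->
    exists l, forall e, 0 < e -> exists n, forall m, (n <= m)%N ->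
      bicomm_norm (u m - l) <= e.
Proof.
move=> /complete_seq[l Hl].
have Cl : commutant (commutant S) l.
  apply: commutant_closed => e /Hl[n Hn]; exists (sval (u n)); last exact: Hn.
  exact: svalP.
by exists (exist _ l Cl).
Qed.

Definition bicomm_cstar : commCStar R :=
  @CommCStar R bicomm bicomm_norm bicomm_st bicomm_sc stK st_sc
    (fun x => nrm_ge0 _) norm_eq0 (fun x y => nrmD _ _) (fun x y => nrmM _ _)
    norm_sc (fun x => nrm_star_mul _) complete.

End Bicommutant.

(** * From prime ideals to points, and the norm estimate *)

Section IdealPoints.
Context (R : realType) (B : commCStar R) (J : set B).
Local Notation C := (complexField R).
Local Notation N := (@cs_norm R B).
Local Notation sc := (@cs_scal R B).
Context (FJ : far_ideal J).
Context (J_prime : forall x y, J (x * y) -> J x \/ J y).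

Record cont_hom (Y : CHaus) (b : cont_alg C Y -> B) : Prop := ContHom {
  cont_hom_cst : forall c, b (ccst Y c) = sc c;
  cont_homD : forall u v, b (u + v) = b u + b v;
  cont_homM : forall u v, b (smul u v) = b u * b v;
  cont_hom_contr : forall (u : cont_alg C Y) (c : R), 0 <= c ->
    (forall x, nrm (u x) <= c) -> N (b u) <= c }.

Definition zero_of (Y : CHaus) (b : cont_alg C Y -> B) (y : Y) : Prop :=
  forall u, J (b u) -> u y = 0.

Lemma cont_hom0 (Y : CHaus) (b : cont_alg C Y -> B) : cont_hom b -> b 0 = 0.
Proof. by move=> hb; have := cont_hom_cst hb 0; rewrite rmorph0. Qed.

(** Otherwise compactness yields a positive, hence invertible, sum of functions
    [u * star u] with [b u] in [J]. *)
Lemma ideal_has_zero (Y : CHaus) (b : cont_alg C Y -> B) :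
  cont_hom b -> exists y, zero_of b y.
Proof.
move=> hb; apply: contrapT => no.
pose Q (S : set Y) := exists2 v : cont_alg C Y, J (b v) &
  (forall z, 0 <= v z) /\ (forall z, S z -> 0 < v z).
have [v Jv [_ v0]] : Q [set: Y].
  apply: (compact_induction (@CHaus_compact Y)).
  - exists 0; first by rewrite cont_hom0 //; exact: far0.
    by split=> [z|z []]; exact: lexx.
  - by move=> S S' SS' [v Jv [v0 vS]]; exists v => //; split=> // z /SS'/vS.
  - move=> S S' [v Jv [v0 vS]] [w Jw [w0 wS]]; exists (v + w).
      by rewrite cont_homD //; exact: farD.
    split=> z; rewrite cont_addE; first exact: addr_ge0.
    by case=> [/vS|/wS] h; [exact: ltr_wpDr|exact: ltr_wpDl].
  - move=> y _; have [u Ju uy] : exists2 u, J (b u) & u y != 0.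
      apply: contrapT => nu; apply: no; exists y => u Ju; apply: contrapT => uy.
      by apply: nu; exists u => //; exact/eqP.
    have unz : \forall z \near y, `|u y - u z| < `|u y|.
      have /(@cvgrPdist_lt _ C^o)/(_ `|u y|) := @cont_continuous _ _ u y.
      by apply; rewrite normr_gt0.
    exists [set z | `|u y - u z| < `|u y|] => //.
    have uuE z : (smul u (star u) : cont_alg C Y) z = `|u z| ^+ 2 by rewrite normCK.
    exists (smul u (star u)); first by rewrite cont_homM //; exact: farM.
    split=> z; rewrite uuE; first exact: exprn_ge0.
    rewrite /= => uz; rewrite exprn_gt0 // normr_gt0; apply: contraTneq uz => ->.
    by rewrite subr0 ltxx.
have cw : continuous (fun y : Y => (v y)^-1 : C).
  move=> y; apply: cvgV; last exact: cont_continuous.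
  by rewrite gt_eqF // v0.
have v1 : smul v (cont_mk cw) = ccst Y 1.
  by apply/cont_algP => y; rewrite cont_mulE mulfV // gt_eqF // v0.
have : J 1 by rewrite -(rmorph1 sc) -(cont_hom_cst hb) -v1 cont_homM //; exact: farM.
by move=> /(far1 FJ); rewrite subrr cs_norm0 ltNge invr_ge0 ler0n.
Qed.

(** A function vanishing near [y] is killed by a bump function at [y], whose
    image is not in [J]; by primality its own image is in [J].  Such functions
    approximate [u - u y]. *)
Lemma ideal_near_value (Y : CHaus) (b : cont_alg C Y -> B) y (u : cont_alg C Y) :
  cont_hom b -> zero_of b y -> near_ideal J (b u - sc (u y)).
Proof.
move=> hb by0 e e0; pose v := u + ccst Y (- u y) : cont_alg C Y.
have vE z : v z = u z - u y by [].
have ec : 0 < (e%:C)%C :> C by rewrite (ltcR 0).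
have vsmall : \forall z \near y, `|v z| <= (e%:C)%C.
  have /(@cvgrPdist_le _ C^o)/(_ _ ec) := @cont_continuous _ _ u y.
  by apply: filterS => z; rewrite vE distrC.
have [phi [phi01 phi1 phi0]] := bump_function R vsmall.
have [psi [psi01 psi1 psi0]] := bump_function R phi1.
pose w := smul v (ccst Y 1 + smul (ccst Y (-1)) phi) : cont_alg C Y.
have wE z : w z = v z * (1 - phi z) by rewrite cont_mulE cont_addE cont_mulE mulN1r.
have Jw : J (b w).
  have : J (b psi * b w).
    rewrite -cont_homM // (_ : smul psi w = 0) ?cont_hom0 //; first exact: far0.
    apply/cont_algP => z; rewrite cont_mulE wE.
    have [phiz|/psi0 ->] := pselect (phi z = 1); last by rewrite mul0r.
    by rewrite phiz subrr !mulr0.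
  case/J_prime => // /by0; rewrite (nbhs_singleton psi1) => /eqP.
  by rewrite oner_eq0.
exists (b w) => //.
have -> : b u - sc (u y) - b w = b (smul v phi).
  have -> : b u = b v + sc (u y).
    rewrite -(cont_hom_cst hb) -cont_homD //; congr (b _).
    by apply/cont_algP => z; rewrite cont_addE vE subrK.
  have -> : b v = b (smul v phi) + b w.
    rewrite -cont_homD //; congr (b _).
    by apply/cont_algP => z; rewrite cont_addE wE cont_mulE; ring.
  by ring.
apply: (cont_hom_contr hb); first exact: ltW.
move=> z; rewrite nrm_le cont_mulE normrM.
have /andP[p0 p1] := phi01 z; rewrite (ger0_norm p0).
have [vz|/phi0 ->] := pselect (`|v z| <= (e%:C)%C); last by rewrite mulr0 ltW.
by rewrite -[leRHS]mulr1 ler_pM.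
Qed.

(** Bump functions separating [g y1] from [h y2] have product [0], while neither
    is sent into [J]. *)
Lemma ideal_zeros_compatible (Y1 Y2 Z : CHaus)
    (b1 : cont_alg C Y1 -> B) (b2 : cont_alg C Y2 -> B)
    (g : continuousType Y1 Z) (h : continuousType Y2 Z) y1 y2 :
  cont_hom b1 -> cont_hom b2 -> zero_of b1 y1 -> zero_of b2 y2 ->
  (forall u, b1 (cont_comp g u) = b2 (cont_comp h u)) -> g y1 = h y2.
Proof.
move=> hb1 hb2 z1 z2 gh; apply: contrapT => /eqP ne.
have := @CHaus_hausdorff Z; rewrite open_hausdorff => /(_ _ _ ne).
move=> [[U1 U2]] /= [/set_mem U1y /set_mem U2y] [oU1 oU2 /eqP U12].
have [|p [p01 p1 p0]] := @bump_function R Z (g y1) U1; first exact: open_nbhs_nbhs.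
have [|q [q01 q1 q0]] := @bump_function R Z (h y2) U2; first exact: open_nbhs_nbhs.
have pq : smul (cont_comp g p) (cont_comp g q) = 0.
  apply/cont_algP => z; rewrite cont_mulE.
  rewrite [cont_comp g p z](_ : _ = p (g z)) // [cont_comp g q z](_ : _ = q (g z)) //.
  have [U1z|/p0 ->] := pselect (U1 (g z)); last by rewrite mul0r.
  rewrite (q0 (g z)) ?mulr0 // => U2z.
  by have : (U1 `&` U2) (g z) by []; rewrite U12.
have : J (b1 (cont_comp g p) * b2 (cont_comp h q)).
  by rewrite -gh -cont_homM // pq cont_hom0 //; exact: far0.
case/J_prime => [/z1|/z2].
  by rewrite [LHS](_ : _ = p (g y1)) // (nbhs_singleton p1) => /eqP; rewrite oner_eq0.
by rewrite [LHS](_ : _ = q (h y2)) // (nbhs_singleton q1) => /eqP; rewrite oner_eq0.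
Qed.

End IdealPoints.

Section PointsOfEffectiveMonic.
Context (X : CHaus) (I : Type) (Y : I -> CHaus) (f : cone X Y).
Context (fM : effective_monic f).

(** Constant maps out of any nonempty space serve to probe points. *)
Definition bool_space : CHaus := MkCHaus bool_compact (@discrete_hausdorff bool).

Definition cst_map (Z : CHaus) (z : Z) : continuousType bool_space Z :=
  mkcts (fun x : bool_space => cvg_cst z).

Lemma effective_monic_separates : separates_points f.
Proof.
move=> x x' fx; have [_ inj _] := fM bool_space.
have : cst_map x = cst_map x'.
  apply: inj; rewrite ?in_setT //; apply: functional_extensionality_dep => i.
  by apply/continuousEP => w; exact: fx.
by move/continuousEP/(_ true).
Qed.

Lemma effective_monic_point (y : forall i, Y i) :
  (forall i j (Z : CHaus)
      (g : continuousType (Y i) Z) (h : continuousType (Y j) Z),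
    CHaus_comp g (f i) = CHaus_comp h (f j) -> g (y i) = h (y j)) ->
  exists x, forall i, f i x = y i.
Proof.
move=> ycomp; have [_ _ surj] := fM bool_space.
have [|a _ ay] := surj (fun i => cst_map (y i)).
  by move=> i j Z g h gh; apply/continuousEP => w; exact: ycomp gh.
exists ((a : continuousType bool_space X) true) => i.
by have /continuousEP/(_ true) := congr1 (fun b => b i) ay.
Qed.

End PointsOfEffectiveMonic.

Section NormEstimate.
Context (R : realType).
Local Notation C := (complexField R).
Context (X : CHaus) (I : Type) (Y : I -> CHaus) (f : cone X Y).
Context (A : cstarAlgType C) (b : forall i, starHom (cont_alg C (Y i)) A).
Context (fM : effective_monic f).
Context (bC : compatible f (F := starHom_functor A) b).
Context (b_comm : forall i j u v, smul (b i u) (b j v) = smul (b j v) (b i u)).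

(** The graph, over the functions generated by the cone, of the morphism to be
    constructed.  Constants are added separately, for an empty cone. *)
Inductive generated : cont_alg C X -> A -> Prop :=
| generated_cst c : generated (ccst X c) (c *: sone)
| generated_base i u : generated (cont_comp (f i) u) (b i u)
| generatedD F T F' T' : generated F T -> generated F' T' ->
    generated (F + F') (T + T')
| generatedM F T F' T' : generated F T -> generated F' T' ->
    generated (smul F F') (smul T T').

Definition b_ranges : set A := [set x | exists i u, x = b i u].

Lemma b_ranges_star x : b_ranges x -> b_ranges (star x).
Proof. by move=> [i [u ->]]; exists i, (star u); rewrite star_morphS. Qed.

Lemma b_ranges_comm x y : b_ranges x -> b_ranges y -> smul x y = smul y x.
Proof. by move=> [i [u ->]] [j [v ->]]; exact: b_comm. Qed.

Let S := StarCommSet b_ranges_star b_ranges_comm.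
Let B := bicomm_cstar S.

Let bB i (u : cont_alg C (Y i)) : B :=
  exist _ (b i u) (sub_bicomm (S := S) (ex_intro _ i (ex_intro _ u erefl))).

Lemma bB_hom i : cont_hom (bB (i := i)).
Proof.
split.
- by move=> c; apply: bicomm_eq; rewrite /= starHom_cst.
- by move=> u v; apply: bicomm_eq; rewrite /= linearD.
- by move=> u v; apply: bicomm_eq; rewrite /= star_morphM.
- by move=> u c c0 uc; exact: starHom_contractive.
Qed.

Lemma generated_star F T : generated F T -> generated (star F) (star T).
Proof.
elim=> [c|i u|{}F {}T F' T' _ h _ h'|{}F {}T F' T' _ h _ h'].
- rewrite starZ star1 (_ : star _ = ccst X c^*); last exact/cont_algP.
  exact: generated_cst.
- rewrite -star_morphS (_ : star _ = cont_comp (f i) (star u)); last exact/cont_algP.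
  exact: generated_base.
- by rewrite !starD; exact: generatedD.
- by rewrite !starM; exact: generatedM.
Qed.

Lemma generated_near (J : set B) (x : X) : far_ideal J ->
  (forall i u, near_ideal J (bB u - cs_scal B (u (f i x)))) ->
  forall F T, generated F T ->
  exists2 t : B, sval (t : bicomm S) = T & near_ideal J (t - cs_scal B (F x)).
Proof.
move=> FJ Jx F T; elim=> [c|i u|{}F {}T F' T' _ [t tT tn] _ [t' tT' tn']|
  {}F {}T F' T' _ [t tT tn] _ [t' tT' tn']].
- exists (cs_scal B c) => //; rewrite subrr => e e0; exists 0; first exact: far0.
  by rewrite subrr cs_norm0 ltW.
- by exists (bB u).
- exists (t + t'); first by rewrite -tT -tT'.
  rewrite cont_addE rmorphD.
  have -> : t + t' - (cs_scal B (F x) + cs_scal B (F' x)) =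
     (t - cs_scal B (F x)) + (t' - cs_scal B (F' x)) by ring.
  exact: near_idealD.
- exists (t * t'); first by rewrite -tT -tT'.
  rewrite cont_mulE rmorphM.
  have -> : t * t' - cs_scal B (F x) * cs_scal B (F' x) =
     (t - cs_scal B (F x)) * t' + (t' - cs_scal B (F' x)) * cs_scal B (F x) by ring.
  by apply: near_idealD => //; exact: near_idealM.
Qed.

Lemma generated_in_bicomm F T : generated F T -> commutant (commutant S) T.
Proof.
elim=> [c|i u|{}F {}T F' T' _ h _ h'|{}F {}T F' T' _ h _ h'].
- by apply: commutantZ; exact: commutant1.
- by apply: sub_bicomm; exists i, u.
- exact: commutantD.
- exact: commutantM.
Qed.

(** A prime ideal attaining the norm of [T] gives a compatible family of points,
    hence a point [x] of [X], and [nrm T = nrm (F x)]. *)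
Lemma generated_norm_le F T (c : R) : generated F T -> 0 <= c ->
  (forall x, nrm (F x) <= c) -> nrm T <= c.
Proof.
move=> GFT c0 Fc; pose t : B := exist _ T (generated_in_bicomm GFT).
have [T0|nT0] := eqVneq (nrm T) 0; first by rewrite T0.
have : 0 < cs_norm t by rewrite lt_neqAle eq_sym nT0; exact: nrm_ge0.
move=> /prime_ideal_attains_norm[J [FJ Jp JT]].
have zero i : {y | zero_of J (bB (i := i)) y}.
  by apply: cid; apply: ideal_has_zero => //; exact: bB_hom.
have [|x fx] := effective_monic_point fM (y := fun i => sval (zero i)).
  move=> i j Z g h gh.
  apply: (ideal_zeros_compatible FJ Jp (bB_hom i) (bB_hom j)).
  - exact: (svalP (zero i)).
  - exact: (svalP (zero j)).
  - move=> u; apply: bicomm_eq.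
    by have /starHomEP/(_ u) := bC gh.
have Jx i u : near_ideal J (bB u - cs_scal B (u (f i x))).
  rewrite fx; apply: ideal_near_value => //; first exact: bB_hom.
  exact: (svalP (zero i)).
have [t1 t1T t1n] := generated_near FJ Jx GFT.
have [t2 t2T t2n] := generated_near FJ Jx (generated_star GFT).
have t1E : t1 = t by apply: bicomm_eq.
have t2E : t2 = cs_star B t by apply: bicomm_eq.
have FxT : nrm (F x) = cs_norm t.
  by apply: JT; [rewrite -t1E|rewrite -t2E].
by apply: le_trans (Fc x); rewrite FxT.
Qed.

End NormEstimate.

(** * Gluing *)

Section StarHomFacts.
Context (R : realType).
Local Notation C := (complexField R).
Context (A : cstarAlgType C).

Lemma starHom_of_fun (B : starAlgType C) (g : B -> A) :
  nmod_morphism g -> scalable g -> g sone = sone ->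
  {morph g : x y / smul x y} -> {morph g : x / star x} ->
  exists h : starHom B A, h =1 g.
Proof.
move=> gD gZ g1 gM gS.
pose m1 := GRing.isNmodMorphism.Build B A g gD.
pose m2 := GRing.isScalable.Build C B A *:%R g gZ.
pose m3 := isStarMorphism.Build C B A g g1 gM gS.
by exists (HB.pack_for (starHom B A) g m1 m2 m3).
Qed.

Lemma starHom_dist_le (X : CHaus) (a : starHom (cont_alg C X) A)
    (u v : cont_alg C X) (e : R) :
  0 <= e -> (forall x, nrm (v x - u x) <= e) -> nrm (a v - a u) <= e.
Proof. by move=> e0 uv; rewrite -linearB; exact: starHom_contractive. Qed.

Lemma subalgebra_dense_nrm (Y : CHaus) (J : Type) (Z : J -> CHaus)
    (g : cone Y Z) (D : set (cont_alg C Y)) :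
  separates_points g -> (forall c, D (ccst Y c)) ->
  (forall u v, D u -> D v -> D (u + v)) ->
  (forall u v, D u -> D v -> D (smul u v)) ->
  (forall j (h : cont_alg C (Z j)), D (cont_comp (g j) h)) ->
  forall (u : cont_alg C Y) (e : R), 0 < e ->
  exists2 v, D v & forall y, nrm (v y - u y) <= e.
Proof.
move=> gs D1 DD DM Dg u e e0.
have [|v Dv vu] := subalgebra_dense gs D1 DD DM Dg u (e := (e%:C)%C).
  by rewrite (ltcR 0).
by exists v => // y; rewrite nrm_le.
Qed.

(** The functions with image in [commutant S] form a closed subalgebra, so it is
    enough that they include those factoring through some [g j]. *)
Lemma starHom_commutant (Y : CHaus) (J : Type) (Z : J -> CHaus)
    (g : cone Y Z) (a : starHom (cont_alg C Y) A) (S : set A) :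
  separates_points g ->
  (forall j h, commutant S (a (cont_comp (g j) h))) ->
  forall u, commutant S (a u).
Proof.
move=> gs aS u; apply: commutant_closed => e e0.
have [|v w Dv Dw|v w Dv Dw|j h|v Dv vu] :=
    @subalgebra_dense_nrm Y J Z g [set u | commutant S (a u)] gs _ _ _ _ u e e0.
- by move=> c; rewrite /= starHom_cst; apply: commutantZ; exact: commutant1.
- by rewrite /= linearD; exact: commutantD.
- by rewrite /= star_morphM; exact: commutantM.
- exact: aS.
by exists (a v) => //; apply: starHom_dist_le => //; exact: ltW.
Qed.

Lemma starHom_eq (Y : CHaus) (J : Type) (Z : J -> CHaus)
    (g : cone Y Z) (a a' : starHom (cont_alg C Y) A) :
  separates_points g ->
  (forall j h, a (cont_comp (g j) h) = a' (cont_comp (g j) h)) -> a = a'.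
Proof.
move=> gs aa'; apply/starHomEP => u; apply: nrm_small => e e0.
have e2 : 0 < e / 2 by rewrite divr_gt0.
have [|v w Dv Dw|v w Dv Dw|j h|v Dv vu] :=
    @subalgebra_dense_nrm Y J Z g [set u | a u = a' u] gs _ _ _ _ u _ e2.
- by move=> c; rewrite /= !starHom_cst.
- by rewrite /= !linearD; congr (_ + _).
- by rewrite /= !star_morphM; congr smul.
- exact: aa'.
have -> : a u - a' u = - (a v - a u) + (a' v - a' u).
  by rewrite Dv opprB addrA subrK.
apply: le_trans (nrmD _ _) _; rewrite nrmN.
have h1 := starHom_dist_le a (ltW e2) vu.
by have h2 := starHom_dist_le a' (ltW e2) vu; lra.
Qed.

Lemma cont_bounded (X : CHaus) (u : cont_alg C X) :
  exists2 M : R, 0 <= M & forall x, nrm (u x) <= M.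
Proof.
pose Q (S : set X) := exists2 M : R, 0 <= M & forall x, S x -> nrm (u x) <= M.
suff [M M0 uM] : Q [set: X] by exists M => // x; exact: uM.
apply: (compact_induction (@CHaus_compact X)).
- by exists 0.
- by move=> S S' SS' [M M0 uM]; exists M => // x /SS'; exact: uM.
- move=> S S' [M M0 uM] [M' M0' uM']; exists (M + M'); first exact: addr_ge0.
  by move=> x [/uM|/uM']; lra.
- move=> x _; exists [set y | `|u x - u y| < 1].
    by have /(@cvgrPdist_lt _ C^o)/(_ _ ltr01) := @cont_continuous _ _ u x.
  exists (nrm (u x) + 1); first by rewrite addr_ge0 ?nrm_ge0.
  move=> y /= xy; have -> : u y = u x + - (u x - u y) by ring.
  apply: le_trans (nrmD _ _) _; rewrite lerD2l nrmN nrm_le; exact: ltW.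
Qed.

End StarHomFacts.

Section Gluing.
Context (R : realType).
Local Notation C := (complexField R).
Context (X : CHaus) (I : Type) (Y : I -> CHaus) (f : cone X Y).
Context (A : cstarAlgType C) (b : forall i, starHom (cont_alg C (Y i)) A).
Context (bC : compatible f (F := starHom_functor A) b).

(** Density has to be used once on each side, since directedness only compares
    one generator of [C(Y i)] with one of [C(Y i')] at a time. *)
Lemma directed_ranges_commute : directed f ->
  forall i j u v, smul (b i u) (b j v) = smul (b j v) (b i u).
Proof.
move=> [J [Z [g [gsep gdir]]]] i i' u v.
have bCE k l (W : CHaus) (p : continuousType (Y k) W)
      (q : continuousType (Y l) W) h :
    CHaus_comp p (f k) = CHaus_comp q (f l) ->
    b k (cont_comp p h) = b l (cont_comp q h).
  by move=> /bC/starHomEP/(_ h).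
apply: (starHom_commutant (gsep i) (S := range (b i'))) => [j h|]; last by exists v.
move=> _ [w _ <-]; symmetry.
apply: (starHom_commutant (gsep i') (S := [set b i (cont_comp (g i j) h)])) => //.
move=> j' h' _ ->.
have [k [p [q [pk qk]]]] := gdir i i' j j'.
rewrite -(bCE _ _ _ _ _ h pk) -(bCE _ _ _ _ _ h' qk) -!star_morphM.
by congr (b k _); apply/cont_algP => z; exact: mulrC.
Qed.

Context (fM : effective_monic f).
Context (b_comm : forall i j u v, smul (b i u) (b j v) = smul (b j v) (b i u)).

Local Notation gen := (generated f b).

Lemma generatedB F T F' T' : gen F T -> gen F' T' -> gen (F - F') (T - T').
Proof.
move=> G G'.
have -> : F - F' = F + smul (ccst X (-1)) F'.
  by apply/cont_algP => x; rewrite [RHS]cont_addE cont_mulE mulN1r.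
have -> : T - T' = T + smul ((-1) *: sone) T' by rewrite smulZl smul1l scaleN1r.
by apply: generatedD => //; apply: generatedM => //; exact: generated_cst.
Qed.

(** The closure of the graph [gen]. *)
Definition glued (u : cont_alg C X) (T : A) : Prop :=
  forall e : R, 0 < e -> exists F T', [/\ gen F T',
    forall x, nrm (F x - u x) <= e & nrm (T' - T) <= e].

Lemma glued_gen F T : gen F T -> glued F T.
Proof.
move=> G e e0; exists F, T; split=> // [x|]; rewrite subrr nrm0; exact: ltW.
Qed.

Lemma glued_norm_le u T c : glued u T -> 0 <= c ->
  (forall x, nrm (u x) <= c) -> nrm T <= c.
Proof.
move=> uT c0 uc; apply/ler_addgt0Pl => e e0.
have [F [T' [G Fu T'T]]] := uT _ (divr_gt0 e0 (ltr0n R 2)).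
have : nrm T' <= c + e / 2.
  apply: (generated_norm_le fM bC b_comm G);
    first by rewrite addr_ge0 // ltW // divr_gt0.
  move=> x; have -> : F x = (F x - u x) + u x by ring.
  by apply: le_trans (nrmD _ _) _; have := Fu x; have := uc x; lra.
have -> : T = - (T' - T) + T' by rewrite opprB subrK.
by move=> h; apply: le_trans (nrmD _ _) _; rewrite nrmN; lra.
Qed.

Lemma gluedD u T u' T' : glued u T -> glued u' T' -> glued (u + u') (T + T').
Proof.
move=> uT uT' e e0; have e2 : 0 < e / 2 by rewrite divr_gt0.
have [F [S [G Fu ST]]] := uT _ e2; have [F' [S' [G' Fu' ST']]] := uT' _ e2.
exists (F + F'), (S + S'); split; first exact: generatedD.
  move=> x; rewrite !cont_addE opprD addrACA; apply: le_trans (nrmD _ _) _.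
  by have := Fu x; have := Fu' x; lra.
by rewrite opprD addrACA; apply: le_trans (nrmD _ _) _; lra.
Qed.

Lemma gluedM u T u' T' : glued u T -> glued u' T' -> glued (smul u u') (smul T T').
Proof.
move=> uT uT' e e0.
have [M M0 uM] := cont_bounded u; have [M' M0' uM'] := cont_bounded u'.
have TM := glued_norm_le uT M0 uM; have TM' := glued_norm_le uT' M0' uM'.
pose d := Num.min 1 (e / (1 + M + M')).
have d0 : 0 < d by rewrite lt_min ltr01 divr_gt0 //; lra.
have d1 : d <= 1 by rewrite ge_min lexx.
have de : d * (1 + M + M') <= e.
  by rewrite -ler_pdivlMr ?ge_min ?lexx ?orbT //; lra.
have bound p q r s : 0 <= p -> 0 <= q -> 0 <= r -> 0 <= s ->
    p <= d -> q <= d -> r <= M -> s <= M' -> p * q + p * s + r * q <= e.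
  move=> *; apply: le_trans de.
  have h1 : p * q <= d * 1 by apply: ler_pM => //; lra.
  have h2 : p * s <= d * M' by apply: ler_pM.
  have h3 : r * q <= M * d by apply: ler_pM.
  lra.
have [F [S [G Fu ST]]] := uT _ d0; have [F' [S' [G' Fu' ST']]] := uT' _ d0.
exists (smul F F'), (smul S S'); split; first exact: generatedM.
  move=> x; rewrite !cont_mulE.
  have -> : F x * F' x - u x * u' x = (F x - u x) * (F' x - u' x) +
      (F x - u x) * u' x + u x * (F' x - u' x) by ring.
  apply: le_trans (bound _ _ _ _ _ _ _ _ (Fu x) (Fu' x) (uM x) (uM' x)) => //;
    try exact: nrm_ge0.
  apply: le_trans (nrmD _ _) _; rewrite -!nrm_mul lerD2r; exact: nrmD.
have -> : smul S S' - smul T T' = smul (S - T) (S' - T') +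
    smul (S - T) T' + smul T (S' - T').
  rewrite -smulDr subrK smulDl smulDr smulNl smulNr.
  by rewrite addrA subrK.
apply: le_trans (bound _ _ _ _ _ _ _ _ ST ST' TM TM') => //; try exact: nrm_ge0.
apply: le_trans (nrmD _ _) _; apply: lerD; last exact: nrmM.
by apply: le_trans (nrmD _ _) _; apply: lerD; exact: nrmM.
Qed.

Lemma glued_star u T : glued u T -> glued (star u) (star T).
Proof.
move=> uT e e0; have [F [S [G Fu ST]]] := uT _ e0.
exists (star F), (star S); split; first exact: generated_star.
  move=> x; apply: le_trans (Fu x).
  rewrite /nrm -(norm_conjC (F x - u x)) rmorphB; exact: lexx.
by rewrite -starN -starD nrm_star.
Qed.

Lemma glued_unique u T T' : glued u T -> glued u T' -> T = T'.
Proof.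
move=> uT uT'; have uZ : glued (smul (ccst X (-1)) u) (smul ((-1) *: sone) T').
  by apply: gluedM => //; apply: glued_gen; exact: generated_cst.
apply: nrm_small => e e0; apply: le_trans (ltW e0).
have -> : T - T' = T + smul ((-1) *: sone) T' by rewrite smulZl smul1l scaleN1r.
apply: (glued_norm_le (gluedD uT uZ)) => // x.
by rewrite cont_addE cont_mulE mulN1r subrr nrm0.
Qed.

(** Along approximations of [u] by generated functions the second components
    are Cauchy, by the norm estimate applied to differences. *)
Lemma glued_exists u : exists T, glued u T.
Proof.
have dense e : 0 < e -> exists p : cont_alg C X * A,
    gen p.1 p.2 /\ forall x, nrm (p.1 x - u x) <= e.
  move=> e0.
  have [|v w [T GT] [T' GT']|v w [T GT] [T' GT']|j h|v [T GT] vu] :=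
    @subalgebra_dense_nrm R X I Y f [set F | exists T, gen F T]
      (effective_monic_separates fM) _ _ _ _ u e e0.
  - by move=> c; exists (c *: sone); exact: generated_cst.
  - by exists (T + T'); exact: generatedD.
  - by exists (smul T T'); exact: generatedM.
  - by exists (b j h); exact: generated_base.
  by exists (v, T).
have [p pP] := choice (fun n : nat => dense _ (@harmonic_gt0 R n)).
have pc n m : nrm ((p n).2 - (p m).2) <= harmonic n + harmonic m :> R.
  have [Gn un] := pP n; have [Gm um] := pP m.
  apply: (generated_norm_le fM bC b_comm (generatedB Gn Gm)).
    by rewrite addr_ge0 ?harmonic_ge0.
  move=> x; rewrite [_ x](_ : _ = ((p n).1 x - u x) - ((p m).1 x - u x)); last first.
    by rewrite opprB addrA subrK.
  by apply: le_trans (nrmD _ _) _; rewrite nrmN lerD.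
have small (e : R) : 0 < e -> exists n, forall m, (n <= m)%N -> harmonic m <= e :> R.
  move=> e0; have /cvgrPdist_le/(_ _ e0)[n _ Hn] := @cvg_harmonic R.
  exists n => m /Hn /=; rewrite sub0r normrN ger0_norm //; exact: harmonic_ge0.
have [|T HT] := @complete_seq R A (fun n => (p n).2).
  move=> e e0; have [n Hn] := small _ (divr_gt0 e0 (ltr0n R 2)).
  by exists n => m k /Hn hm /Hn hk; apply: le_trans (pc _ _) _; lra.
exists T => e e0; have [n Hn] := small _ e0; have [m Hm] := HT _ e0.
have [G Gu] := pP (maxn n m); exists (p (maxn n m)).1, (p (maxn n m)).2; split=> //.
  by move=> x; apply: le_trans (Gu x) _; apply: Hn; exact: leq_maxl.
by apply: Hm; exact: leq_maxr.
Qed.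

Lemma glued_starHom : exists a : starHom (cont_alg C X) A,
  forall i u, a (cont_comp (f i) u) = b i u.
Proof.
have [g gP] := choice glued_exists.
have gE u T : glued u T -> g u = T by exact: glued_unique (gP u).
have gcst c : g (ccst X c) = c *: sone by apply/gE/glued_gen/generated_cst.
have gM : {morph g : u v / smul u v >-> smul u v} by move=> u v; apply/gE/gluedM.
have [|||||a aE] := @starHom_of_fun R A (cont_alg C X) g.
- split; first by have := gcst 0; rewrite scale0r.
  by move=> u v; apply/gE/gluedD.
- move=> c u; have -> : c *: u = smul (ccst X c) u by exact/cont_algP.
  by rewrite gM gcst smulZl smul1l.
- by have := gcst 1; rewrite scale1r.
- exact: gM.
- by move=> u; apply/gE/glued_star.
by exists a => i u; rewrite aE; apply/gE/glued_gen/generated_base.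
Qed.

End Gluing.

Theorem proposition3p20 (R : realType) (X : CHaus) (I : Type)
    (Y : I -> CHaus) (f : cone X Y) :
  effective_monic f -> directed f -> guaranteed_commutative R f.
Proof.
move=> fM fD A; split.
- by move=> a _ i j Z g h gh; rewrite -!Defs.fmap_comp gh.
- move=> a a' _ _ aa'; apply: (starHom_eq (effective_monic_separates fM)) => i u.
  by have /starHomEP/(_ u) := congr1 (fun b => b i) aa'.
- move=> b bC; have b_comm := directed_ranges_commute bC fD.
  have [a ab] := glued_starHom bC fM b_comm; exists a => //.
  by apply: functional_extensionality_dep => i; apply/starHomEP => u; exact: ab.
Qed.
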